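(* Let a group $G$ act on the strongly locally finite CAT(0) cube complex $\mathbf X$ and let $g\in G$ be a combinatorially rank-one element. Suppose that for all $n>0$ and all hyperplanes $H$, $g^n\notin\mathrm{Stab}_G(H)$. Then $g$ has a quasi-geodesic axis in the contact graph $\Gamma\mathbf X$.
   Context: A CAT(0) cube complex is a simply connected cube complex (cubes $[-\frac12,\frac12]^d$, $d$ finite) with flag vertex links; hyperplanes are connected subspaces meeting each cube in a midcube or not at all; their carriers are the unions of closed cubes meeting them. Hyperplanes cross if all four intersections of their halfspaces are nonempty and contact if their carriers meet. $\mathbf X$ is strongly locally finite if it is locally finite and every family of pairwise-crossing hyperplanes is finite. $G$ acts by cubical automorphisms, hence on the set of hyperplanes and by isometries on the contact graph $\Gamma\mathbf X$ (vertices the hyperplanes, adjacent iff distinct and contacting). An element $g$ is combinatorially hyperbolic if there is a bi-infinite combinatorial geodesic $\gamma:\mathbb R\to\mathbf X^1$ (geodesic in the 1-skeleton path metric) and $\tau>0$ with $g\gamma(t)=\gamma(t+\tau)$ for all $t$ (a combinatorial axis). A half-flat is a cube complex isomorphic either to the standard square tiling of $\mathbb R\times[0,\infty)$, or to the closure of a complementary component of a bi-infinite combinatorial geodesic crossing every hyperplane in the standard square tiling of $\mathbb R^2$. A combinatorially hyperbolic $g$ is combinatorially rank-one if some (equivalently every) combinatorial axis of $g$ does not lie in an isometrically embedded half-flat in $\mathbf X$. A quasi-geodesic axis of $g$ in $\Gamma\mathbf X$ is a $\langle g\rangle$-invariant bi-infinite quasi-geodesic in $\Gamma\mathbf X$.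 *)

(* Defs.v *)
From Stdlib Require Import ZArith Relation_Operators.
From mathcomp Require Import all_boot all_fingroup.

Set Implicit Arguments.
Unset Strict Implicit.
Unset Printing Implicit Defensive.

Definition walk {T : Type} (r : T -> T -> Prop) (x y : T) (n : nat) : Prop :=
  exists f : nat -> T, f 0%N = x /\ f n = y /\ forall i, (i < n)%N -> r (f i) (f i.+1).

Definition is_dist {T : Type} (r : T -> T -> Prop) (x y : T) (n : nat) : Prop :=
  walk r x y n /\ forall m, walk r x y m -> (n <= m)%N.

(* A cube of dimension d is given by its (injective) vertex map         *)
(* {0,1}^d -> V ; the same cube appears under all symmetries of the     *)
(* standard cube.                                                        *)

Definition cvec (d : nat) := {ffun 'I_d -> bool}.

Record cube_complex (V : Type) := CubeComplex {
  cube : forall d : nat, (cvec d -> V) -> Prop }.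

Definition zerov (d : nat) : cvec d := [ffun _ => false].
Definition onesv (d : nat) : cvec d := [ffun _ => true].
Definition unitv (d : nat) (i : 'I_d) : cvec d := [ffun j => j == i].
Definition symv (d : nat) (p : {perm 'I_d}) (b : cvec d) (x : cvec d) : cvec d :=
  [ffun i => addb (x (p i)) (b i)].
Definition permv (d : nat) (p : {perm 'I_d}) (x : cvec d) : cvec d :=
  [ffun i => x (p i)].
Definition face_last (d : nat) (x : cvec d) : cvec d.+1 :=
  [ffun i => if unlift ord_max i is Some j then x j else false].

Definition c00 : cvec 2 := [ffun _ => false].
Definition c10 : cvec 2 := [ffun i : 'I_2 => i == ord0].
Definition c01 : cvec 2 := [ffun i : 'I_2 => i == ord_max].
Definition c11 : cvec 2 := [ffun _ => true].

Section CubeComplexDefs.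
Variable V : Type.
Variable X : cube_complex V.

Definition is_cube_complex : Prop :=
  (forall v : V, cube X (fun _ : cvec 0 => v)) /\
  (forall d (s : cvec d -> V), cube X s -> injective s) /\
  (forall d (s t : cvec d -> V), cube X s -> (forall x, s x = t x) -> cube X t) /\
  (forall d (s : cvec d -> V) (p : {perm 'I_d}) (b : cvec d),
      cube X s -> cube X (fun x => s (symv p b x))) /\
  (forall d (s : cvec d.+1 -> V), cube X s -> cube X (fun x => s (face_last x))).

Definition adj (u v : V) : Prop :=
  exists s : cvec 1 -> V, cube X s /\ s (zerov 1) = u /\ s (onesv 1) = v.

Fixpoint epath (p : seq V) : Prop :=
  match p with
  | x :: ((y :: _) as q) => adj x y /\ epath q
  | _ => True
  end.

Inductive hmove : seq V -> seq V -> Prop :=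
| hm_back (s t : seq V) (u v : V) :
    adj u v -> hmove (s ++ u :: v :: u :: t) (s ++ u :: t)
| hm_square (s t : seq V) (q : cvec 2 -> V) :
    cube X q ->
    hmove (s ++ q c00 :: q c10 :: q c11 :: t) (s ++ q c00 :: q c01 :: q c11 :: t).

Definition homotopic : seq V -> seq V -> Prop := clos_refl_sym_trans (seq V) hmove.

(* simple connectivity of the realization (edge-path group of the 2-skeleton) *)
Definition simply_connected : Prop :=
  (forall u v, exists n, walk adj u v n) /\
  (forall (v : V) (p : seq V), epath (v :: p) -> last v p = v -> homotopic (v :: p) [:: v]).

(* the link of every vertex is a simplicial complex: a cube at v is       *)
(* determined (up to the corner-fixing symmetries) by its edges at v      *)
Definition link_simplicial : Prop :=
  forall v d (s t : cvec d -> V), cube X s -> cube X t ->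
    s (zerov d) = v -> t (zerov d) = v ->
    (forall u, (exists i, s (unitv i) = u) <-> (exists i, t (unitv i) = u)) ->
    exists p : {perm 'I_d}, forall x, t x = s (permv p x).

Definition link_flag : Prop :=
  forall v d (n : 'I_d -> V), injective n -> (forall i, adj v (n i)) ->
    (forall i j, i != j -> exists q : cvec 2 -> V,
        cube X q /\ q c00 = v /\ q c10 = n i /\ q c01 = n j) ->
    exists t : cvec d -> V, cube X t /\ t (zerov d) = v /\ forall i, t (unitv i) = n i.

Definition CAT0_cube_complex : Prop :=
  is_cube_complex /\ simply_connected /\ link_simplicial /\ link_flag.

Inductive par1 : V * V -> V * V -> Prop :=
| par_rev u v : adj u v -> par1 (u, v) (v, u)
| par_sq (q : cvec 2 -> V) : cube X q -> par1 (q c00, q c10) (q c01, q c11).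

(* a hyperplane is identified with its set of dual (oriented) edges:     *)
(* a parallelism class of edges                                          *)
Definition hyperplane (H : V -> V -> Prop) : Prop :=
  exists u v, adj u v /\
    forall x y, H x y <-> clos_refl_sym_trans (V * V) par1 (u, v) (x, y).

(* u and w lie in the same halfspace of H *)
Definition halfsame (H : V -> V -> Prop) (u w : V) : Prop :=
  exists n, walk (fun x y => adj x y /\ ~ H x y) u w n.

Definition cross (H H' : V -> V -> Prop) : Prop :=
  exists x y x' y', H x y /\ H' x' y' /\
    forall s t : bool, exists p,
      halfsame H (if s then x else y) p /\ halfsame H' (if t then x' else y') p.

(* carriers meet (the vertex set of the carrier of H is the set of endpoints *)
(* of edges dual to H)                                                      *)
Definition contact (H H' : V -> V -> Prop) : Prop :=
  exists w y y', H w y /\ H' w y'.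

Definition contact_adj (H H' : V -> V -> Prop) : Prop :=
  hyperplane H /\ hyperplane H' /\ H <> H' /\ contact H H'.

Definition locally_finite : Prop :=
  forall v : V, exists L : seq V,
    forall d (s : cvec d -> V) (x : cvec d), cube X s -> (exists y, s y = v) -> List.In (s x) L.

Definition strongly_locally_finite : Prop :=
  locally_finite /\
  forall F : (V -> V -> Prop) -> Prop,
    (forall H, F H -> hyperplane H) ->
    (forall H H', F H -> F H' -> H <> H' -> cross H H') ->
    exists L : seq (V -> V -> Prop), forall H, F H -> List.In H L.

Definition comb_geodesic (c : Z -> V) : Prop :=
  forall i j : Z, is_dist adj (c i) (c j) (Z.abs_nat (i - j)).

Definition hf_std (x : Z * Z) : Prop := (0 <= x.2)%Z.

(* bi-infinite monotone staircase in Z^2 crossing every hyperplane of the tiling *)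
Definition staircase (p : Z -> Z * Z) : Prop :=
  (forall i, p (i + 1)%Z = ((p i).1 + 1, (p i).2)%Z \/ p (i + 1)%Z = ((p i).1, (p i).2 + 1)%Z) /\
  (forall k, exists i, (p i).1 = k) /\ (forall k, exists i, (p i).2 = k).

(* vertex set of the closure of the upper-left complementary component *)
Definition hf_stair (p : Z -> Z * Z) (x : Z * Z) : Prop :=
  exists i, (p i).1 = x.1 /\ ((p i).2 <= x.2)%Z.

Definition is_half_flat (R : Z * Z -> Prop) : Prop :=
  (forall x, R x <-> hf_std x) \/
  (exists p, staircase p /\ forall x, R x <-> hf_stair p x).

(* 1-skeleton of the (full) subcomplex of the square tiling spanned by R *)
Definition grid_adj (R : Z * Z -> Prop) (x y : Z * Z) : Prop :=
  R x /\ R y /\ (Z.abs_nat (x.1 - y.1) + Z.abs_nat (x.2 - y.2))%N = 1%N.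

Definition iso_half_flat (R : Z * Z -> Prop) (phi : Z * Z -> V) : Prop :=
  is_half_flat R /\
  (forall x y n, R x -> R y -> (is_dist (grid_adj R) x y n <-> is_dist adj (phi x) (phi y) n)) /\
  (forall a b : Z, R (a, b) -> R (a + 1, b)%Z -> R (a, b + 1)%Z -> R (a + 1, b + 1)%Z ->
     exists q : cvec 2 -> V, cube X q /\ q c00 = phi (a, b) /\ q c10 = phi (a + 1, b)%Z /\
        q c01 = phi (a, b + 1)%Z /\ q c11 = phi (a + 1, b + 1)%Z).

Definition lies_in_half_flat (c : Z -> V) : Prop :=
  exists (R : Z * Z -> Prop) (phi : Z * Z -> V),
    iso_half_flat R phi /\ forall i, exists x, R x /\ phi x = c i.

End CubeComplexDefs.

Definition is_group (G : Type) (mul : G -> G -> G) (one : G) (inv : G -> G) : Prop :=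
  (forall a b c, mul a (mul b c) = mul (mul a b) c) /\
  (forall a, mul one a = a) /\ (forall a, mul a one = a) /\
  (forall a, mul (inv a) a = one) /\ (forall a, mul a (inv a) = one).

Definition cubical_action (V G : Type) (X : cube_complex V)
    (mul : G -> G -> G) (one : G) (act : G -> V -> V) : Prop :=
  (forall x, act one x = x) /\
  (forall g h x, act (mul g h) x = act g (act h x)) /\
  (forall g d (s : cvec d -> V), cube X s -> cube X (fun x => act g (s x))).

Definition gpow (G : Type) (mul : G -> G -> G) (one : G) (g : G) (n : nat) : G :=
  iter n (mul g) one.

Definition hact (V G : Type) (act : G -> V -> V) (g : G) (H : V -> V -> Prop) : V -> V -> Prop :=
  fun x y => exists x0 y0, H x0 y0 /\ act g x0 = x /\ act g y0 = y.

Definition comb_axis (V G : Type) (X : cube_complex V) (act : G -> V -> V) (g : G) (c : Z -> V) : Prop :=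
  comb_geodesic X c /\ exists tau : nat, (0 < tau)%N /\ forall i, act g (c i) = c (i + Z.of_nat tau)%Z.

Definition comb_rank_one (V G : Type) (X : cube_complex V) (act : G -> V -> V) (g : G) : Prop :=
  exists c : Z -> V, comb_axis X act g c /\ ~ lies_in_half_flat X c.

Definition has_qg_axis_contact (V G : Type) (X : cube_complex V) (act : G -> V -> V) (g : G) : Prop :=
  exists (gam : Z -> (V -> V -> Prop)) (lam c : nat),
    (forall i, hyperplane X (gam i)) /\
    (forall i j : Z, exists n, is_dist (contact_adj X) (gam i) (gam j) n /\
        (Z.abs_nat (i - j) <= lam * (n + c))%N /\ (n <= lam * Z.abs_nat (i - j) + c)%N) /\
    (forall i, exists j, hact act g (gam i) = gam j) /\
    (forall j, exists i, hact act g (gam i) = gam j).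

(* Main.v *)
Require Import Defs.
From Stdlib Require Import ZArith Relation_Operators.
From Stdlib Require FinFun.
From Stdlib Require Import Classical ClassicalEpsilon FunctionalExtensionality PropExtensionality.
From mathcomp Require Import all_boot all_fingroup.
From mathcomp Require Import zify.

Set Implicit Arguments.
Unset Strict Implicit.
Unset Printing Implicit Defensive.

(* Edge paths are normalised by deleting a pair of edges joined by a ladder of
   squares, modulo flipping corners of squares; the flag condition on links makes
   the normal form invariant under homotopy.  Simple connectivity then yields the
   quadrangle condition for the 1-skeleton, hence the two convex halfspaces of a
   hyperplane.

   Let h_i be the halfspace, containing the positive end of the axis c, of the
   hyperplane dual to the edge from c(i) to c(i+1).  No infinite family of
   hyperplanes crosses pairwise, so h_(i+N) lies inside h_i for some period N.  A
   path of length n in the contact graph from the hyperplane of h_i to that of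
   h_j is a chain of carriers joining c(i+1) to c(j), so each wall h_l in between
   is straddled by one of n+1 carriers.  If carriers straddle boundedly many of
   the h_(Nk), the hyperplanes h_i therefore form a quasi-geodesic.  Otherwise, on
   arbitrarily long windows, a carrier has a constant position (on the positive
   side, straddling, or on the negative side) relative to each residue class
   mod N.  If some class is not straddled, the classes split into two parts whose
   walls cross in the pattern of a staircase, and the axis bounds a staircase
   half-flat.  If all classes are straddled, then, since no power of g fixes a
   hyperplane, the straddling carriers can be taken arbitrarily far away;
   geodesics from c(0) to them cross only hyperplanes crossing a long part of the
   axis, and a limit ray spans with the axis a standard half-flat. *)

(** * Squares and three-dimensional cubes of the complex *)

Section Squares.
Variables (V : Type) (X : cube_complex V).
Hypothesis HX : CAT0_cube_complex X.

Definition Sq (a b c d : V) : Prop :=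
  exists q : cvec 2 -> V,
    [/\ cube X q, q c00 = a, q c10 = b, q c01 = c & q c11 = d].

Lemma ord2P (i : 'I_2) : i = ord0 \/ i = ord_max.
Proof. by case: i => [[|[|//]] hi]; [left|right]; apply: val_inj. Qed.

Lemma cube_sym d (s : cvec d -> V) (p : {perm 'I_d}) (b : cvec d) :
  cube X s -> cube X (fun x => s (symv p b x)).
Proof. by case: HX => [[_ [_ [_ [H _]]]] _]; apply: H. Qed.

Lemma cube_face d (s : cvec d.+1 -> V) : cube X s -> cube X (fun x => s (face_last x)).
Proof. by case: HX => [[_ [_ [_ [_ H]]]] _]; apply: H. Qed.

Lemma cube_inj d (s : cvec d -> V) : cube X s -> injective s.
Proof. by case: HX => [[_ [H _]] _]; apply: H. Qed.

Lemma Sq_swap a b c d : Sq a b c d -> Sq a c b d.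
Proof.
move=> [q [hq <- <- <- <-]].
exists (fun x => q (symv (tperm ord0 ord_max) (zerov 2) x)).
by split; first exact: cube_sym;
  congr (q _); apply/ffunP => i; rewrite !ffunE //=;
  case: (ord2P i) => ->; rewrite ?tpermL ?tpermR ?ffunE.
Qed.

Lemma Sq_flip a b c d : Sq a b c d -> Sq b a d c.
Proof.
move=> [q [hq <- <- <- <-]].
exists (fun x => q (symv 1%g c10 x)).
by split; first exact: cube_sym;
  congr (q _); apply/ffunP => i; rewrite !ffunE ?perm1 ?ffunE //=;
  case: (ord2P i) => ->.
Qed.

Lemma Sq_adj a b c d : Sq a b c d -> adj X a b.
Proof.
move=> [q [hq <- <- _ _]].
exists (fun x => q (face_last x)); split; first exact: cube_face.
by split; congr (q _); apply/ffunP => i; rewrite !ffunE; case: unliftP => [j hj|hj] //=;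
  rewrite ?ffunE // ?hj //; apply/esym/eqP; apply: val_inj => /=; case: j {hj} => [[]].
Qed.

Lemma Sq_neq a b c d : Sq a b c d -> b <> c.
Proof.
move=> [q [hq _ <- <- _]] /(cube_inj hq) /ffunP /(_ ord0).
by rewrite !ffunE.
Qed.

Lemma Sq_neq_diag a b c d : Sq a b c d -> a <> d.
Proof. by move=> /Sq_flip /Sq_neq. Qed.

Lemma adj_sym a b : adj X a b -> adj X b a.
Proof.
move=> [s [hs [<- <-]]].
exists (fun x => s (symv 1%g (onesv 1) x)); split; first exact: cube_sym.
by split; congr (s _); apply/ffunP => i; rewrite !ffunE ?perm1 ?ffunE.
Qed.

Lemma adj_neq a b : adj X a b -> a <> b.
Proof.
move=> [s [hs [<- <-]]] /(cube_inj hs) /ffunP /(_ ord0).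
by rewrite !ffunE.
Qed.

(** The two squares have the same edges at [a], so simpliciality of the link makes them differ by a
    permutation of coordinates, which fixes the corner [c11]. *)
Lemma Sq_uniq a b c d d' : Sq a b c d -> Sq a b c d' -> d = d'.
Proof.
move=> [q [hq qa qb qc <-]] [q' [hq' qa' qb' qc' <-]].
case: HX => _ [_ [HL _]].
have E0 : zerov 2 = c00 by [].
have E1 : unitv ord0 = c10 by apply/ffunP => i; rewrite !ffunE.
have E2 : unitv ord_max = c01 by apply/ffunP => i; rewrite !ffunE.
have [||u|p hp] := HL a 2 q q' hq hq'; rewrite ?E0 //.
  split=> -[i <-]; case: (ord2P i) => ->; rewrite ?E1 ?E2 ?qb ?qc ?qb' ?qc'.
  - by exists ord0; rewrite E1 qb'.
  - by exists ord_max; rewrite E2 qc'.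
  - by exists ord0; rewrite E1 qb.
  - by exists ord_max; rewrite E2 qc.
by rewrite hp; congr (q _); apply/ffunP => i; rewrite !ffunE.
Qed.

Lemma cube3_face (t : cvec 3 -> V) (b : cvec 3) (i j : 'I_3) :
  cube X t -> i != j ->
  Sq (t b) (t [ffun k => b k (+) (k == i)]) (t [ffun k => b k (+) (k == j)])
     (t [ffun k => b k (+) (k == i) (+) (k == j)]).
Proof.
move=> ht nij; pose o1 : 'I_3 := lift ord0 ord0.
pose a := tperm i ord0 j.
have na : a != ord0 by apply/negP => /eqP; rewrite /a -[RHS](tpermL i ord0) => /perm_inj /eqP; rewrite eq_sym (negPf nij).
(* [p] moves [i] and [j] to the first two coordinates, so that the face with vanishing last
   coordinate runs in the directions [i] and [j]. *)
pose p := (tperm i ord0 * tperm a o1)%g.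
have pi : p i = ord0 by rewrite permM tpermL tpermD.
have pj : p j = o1 by rewrite permM -/a tpermL.
exists (fun x => t (symv p b (face_last x))).
have fl (x : cvec 2) k : face_last x (p k) =
    ((k == i) && x ord0) || ((k == j) && x ord_max).
  rewrite ffunE; case: unliftP => [m hm|hm].
    case: (ord2P m) => em; rewrite em in hm *.
      have /eqP -> : k == i by rewrite -(inj_eq (@perm_inj _ p)) pi hm; apply/eqP/val_inj.
      by rewrite eqxx (negPf nij) orbF.
    have /eqP -> : k == j by rewrite -(inj_eq (@perm_inj _ p)) pj hm; apply/eqP/val_inj.
    by rewrite eqxx eq_sym (negPf nij).
  have -> : (k == i) = false by apply/negP => /eqP ek; move: hm; rewrite ek pi => /(congr1 val).
  by have -> : (k == j) = false by apply/negP => /eqP ek; move: hm; rewrite ek pj => /(congr1 val).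
split.
- by apply: (@cube_face 2 (fun x => t (symv p b x))); exact: cube_sym.
all: congr (t _); apply/ffunP => k; rewrite [LHS]ffunE fl !ffunE ?andbF ?andbT ?orbF //= addbC //.
case: (eqVneq k i) => [->|_] //=; last by rewrite addbF.
by rewrite (negPf nij) addbF.
Qed.

(** By flagness the three edges at [w] span a cube; uniqueness of squares identifies its faces at
    [w] with the given ones, and the faces at the opposite vertex [t] are the squares sought. *)
Lemma Sq_cube w x y z p q r : Sq w x y p -> Sq w x z q -> Sq w y z r ->
  exists t, [/\ Sq x p q t, Sq y p r t & Sq z q r t].
Proof.
move=> hxy hxz hyz; case: (HX) => _ [_ [_ HF]].
pose n (i : 'I_3) := if val i is 0 then x else if val i is 1 then y else z.
pose o0 : 'I_3 := ord0; pose o1 : 'I_3 := lift ord0 ord0; pose o2 : 'I_3 := ord_max.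
have ord3P (i : 'I_3) : [\/ i = o0, i = o1 | i = o2].
  by case: i => [[|[|[|//]]] hi]; [constructor 1|constructor 2|constructor 3]; apply: val_inj.
have sqn i j : i != j -> exists d, Sq w (n i) (n j) d.
  case: (ord3P i) => ->; case: (ord3P j) => -> //= _; 
  by [exists p|exists q|exists p; apply: Sq_swap|exists r|exists q; apply: Sq_swap|exists r; apply: Sq_swap].
have [|i|i j nij|t [ht [t0 tu]]] := HF w 3 n.
- move=> i j; case: (eqVneq i j) => // /sqn [d /Sq_neq]; contradiction.
- by case: (ord3P i) => ->; [exact: (Sq_adj hxy)|exact: (Sq_adj hyz)|exact: (Sq_adj (Sq_swap hyz))].
- by have [d [s [hs s0 s1 s2 _]]] := sqn i j nij; exists s.
pose u2 (i j : 'I_3) : cvec 3 := [ffun k => (k == i) || (k == j)].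
have bot i j d : i != j -> Sq w (n i) (n j) d -> t (u2 i j) = d.
  move=> nij hd; have := cube3_face (zerov 3) ht nij; rewrite t0.
  have -> : [ffun k => zerov 3 k (+) (k == i)] = unitv i by apply/ffunP => k; rewrite !ffunE.
  have -> : [ffun k => zerov 3 k (+) (k == j)] = unitv j by apply/ffunP => k; rewrite !ffunE.
  rewrite !tu => /Sq_uniq /(_ hd) <-; congr (t _); apply/ffunP => k; rewrite !ffunE /=.
  by case: (eqVneq k i) => [->|] //=; rewrite (negPf nij).
have bp := bot o0 o1 p isT hxy; have bq := bot o0 o2 q isT hxz; have br := bot o1 o2 r isT hyz.
exists (t (onesv 3)).
have top i j k : i != j -> i != k -> j != k ->
    Sq (n i) (t (u2 i j)) (t (u2 i k)) (t (onesv 3)).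
  move=> nij nik njk; have := cube3_face (unitv i) ht njk; rewrite tu.
  have -> : [ffun l => unitv i l (+) (l == j)] = u2 i j.
    by apply/ffunP => l; rewrite !ffunE; case: (eqVneq l i) => [->|] //; rewrite (negPf nij).
  have -> : [ffun l => unitv i l (+) (l == k)] = u2 i k.
    by apply/ffunP => l; rewrite !ffunE; case: (eqVneq l i) => [->|] //; rewrite (negPf nik).
  have -> // : [ffun l => unitv i l (+) (l == j) (+) (l == k)] = onesv 3.
  apply/ffunP => l; rewrite !ffunE.
  by move: nij nik njk; case: (ord3P i) => ->; case: (ord3P j) => ->; case: (ord3P k) => ->;
     case: (ord3P l) => ->.
have u2C i j : u2 i j = u2 j i by apply/ffunP => k; rewrite !ffunE orbC.
split.
- by have := top o0 o1 o2 isT isT isT; rewrite bp bq.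
- by have := top o1 o0 o2 isT isT isT; rewrite u2C bp br.
- by have := top o2 o0 o1 isT isT isT; rewrite u2C bq u2C br.
Qed.

End Squares.

(** * Normal forms of edge paths under cancellation and flips of squares *)

Section NormalForms.
Variables (V : Type) (X : cube_complex V).
Hypothesis HX : CAT0_cube_complex X.
Local Notation Sq := (Sq X).

Inductive flip : seq V -> seq V -> Prop :=
| flip_here a b c d t : Sq a b c d -> flip (a :: b :: d :: t) (a :: c :: d :: t)
| flip_cons x p q : flip p q -> flip (x :: p) (x :: q).

Definition feq : seq V -> seq V -> Prop := clos_refl_sym_trans _ flip.

(* Paths are listed from their endpoint backwards.  [Del w p q]: the edge from the
   head of [p] to [w], transported backwards along [p] through a ladder of
   squares, reaches an edge of [p]; the two cancel and leave the path [q] to [w]. *)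
Inductive Del : V -> seq V -> seq V -> Prop :=
| Del_hit v w t : Del w (v :: w :: t) (w :: t)
| Del_sq v v' w w' t q : Sq v w v' w' -> Del w' (v' :: t) q -> Del w (v :: v' :: t) (w :: q).

Lemma flip_sym p q : flip p q -> flip q p.
Proof.
elim=> [a b c d t h|x {}p {}q _ h]; last exact: flip_cons.
by apply: flip_here; apply: Sq_swap.
Qed.

Lemma feq_refl p : feq p p. Proof. exact: rst_refl. Qed.
Lemma feq_sym p q : feq p q -> feq q p. Proof. exact: rst_sym. Qed.
Lemma feq_trans p q r : feq p q -> feq q r -> feq p r. Proof. exact: rst_trans. Qed.

Lemma feq_cons x p q : feq p q -> feq (x :: p) (x :: q).
Proof.
elim=> [{}p {}q h|{}p|{}p {}q _ h|{}p {}q r _ h1 _ h2].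
- by apply: rst_step; apply: flip_cons.
- exact: feq_refl.
- exact: feq_sym.
- exact: feq_trans h2.
Qed.

Lemma Del_head w p q : Del w p q -> exists q', q = w :: q'.
Proof. by case=> *; eexists. Qed.

Lemma Del_size w p q : Del w p q -> size p = (size q).+1.
Proof. by elim=> //= *; congr _.+1. Qed.

Lemma Del_inv w v v' t q : Del w (v :: v' :: t) q ->
  (w = v' /\ q = w :: t) \/
  (exists w' q', [/\ Sq v w v' w', Del w' (v' :: t) q' & q = w :: q']).
Proof.
move=> h; inversion h; subst; first by left.
by right; exists w', q0.
Qed.

Lemma Del_fun w p q q' : Del w p q -> Del w p q' -> q = q'.
Proof.
move=> h; elim: h q' => {w p q} [v w t|v v' w w' t q hs _ IH] q' /Del_inv [[e ->]|[w2 [q2 [h1 h2 ->]]]] //.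
- by case: (Sq_neq HX h1).
- by case: (Sq_neq HX hs).
- by congr (_ :: _); apply: IH; rewrite (Sq_uniq HX hs h1).
Qed.

(* The cube condition enters here: when the ladder passes over a square of the
   path, the three squares at the middle vertex span a cube, and the opposite
   face of that cube carries the flipped ladder. *)
Lemma Del_flip w p p' q : flip p p' -> Del w p q -> exists2 q', Del w p' q' & feq q q'.
Proof.
move=> hf; elim: hf w q => {p p'} [a b c d t hs|x p p' hf IH] w q hd.
  case/Del_inv: hd => [[-> ->]|[w' [q1 [h1 h2 ->]]]].
    exists (b :: d :: t); last exact: feq_refl.
    by apply: (Del_sq hs); apply: Del_hit.
  case/Del_inv: h2 => [[e ->]|[w'' [q2 [h3 h4 ->]]]].
    subst w'; have e : w = c.
      by apply: (Sq_uniq HX (Sq_flip HX (Sq_swap HX h1))); apply: Sq_flip.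
    by subst w; exists (c :: d :: t); [apply: Del_hit|apply: feq_refl].
  have [s [s1 s2 s3]] :=
    Sq_cube HX (Sq_flip HX (Sq_swap HX h1)) (Sq_flip HX hs) h3.
  have [q3 e3] := Del_head h4; subst q2.
  exists (w :: s :: w'' :: q3).
    by apply: (Del_sq s1); apply: (Del_sq _ h4); apply/Sq_swap/Sq_flip.
  by apply: rst_step; apply: flip_here; apply: Sq_flip.
have [v' [t [t' [e e']]]] : exists v' t t', p = v' :: t /\ p' = v' :: t'.
  by case: hf => *; eexists _, _, _.
subst p p'; case/Del_inv: hd => [[-> ->]|[w' [q1 [h1 /IH [q2 h2 h3] ->]]]].
  by exists (v' :: t'); [apply: Del_hit|apply: rst_step].
by exists (w :: q2); [apply: Del_sq h1 h2|apply: feq_cons].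
Qed.

Lemma Del_feq w p p' q : feq p p' -> Del w p q -> exists2 q', Del w p' q' & feq q q'.
Proof.
move=> h; suff [H _] : (forall q, Del w p q -> exists2 q', Del w p' q' & feq q q') /\
  (forall q, Del w p' q -> exists2 q', Del w p q' & feq q q') by apply: H.
elim: h => {q p p'} [p p' h|p|p p' _ [h1 h2]|p p' p'' _ [h1 h2] _ [h3 h4]].
- by split=> q; apply: Del_flip => //; apply: flip_sym.
- by split=> q hq; exists q => //; apply: feq_refl.
- by split.
- split=> q.
    by move=> /h1 [q1 /h3 [q2 hq2 e2] e1]; exists q2 => //; apply: feq_trans e2.
  by move=> /h4 [q1 /h2 [q2 hq2 e2] e1]; exists q2 => //; apply: feq_trans e2.
Qed.

(** Flipping the squares of the ladder one after the other carries the cancelled edge to the end of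
    the path. *)
Lemma Del_back w v t q : Del w (v :: t) q -> feq (v :: q) (v :: t).
Proof.
move=> h; move: {1 2}(v :: t) h (erefl (v :: t)) => p h.
elim: h v t => {w p q} [v0 w t0|v0 v' w w' t0 q hs hd IH] v t [<- <-]; first exact: feq_refl.
have [q1 e] := Del_head hd; subst q.
apply: (@feq_trans _ (v0 :: v' :: w' :: q1)); first by apply: rst_step; apply: flip_here.
by apply: feq_cons; apply: IH.
Qed.

(** Tails of the list are initial pieces of the path, so no edge cancels against an earlier one. *)
Fixpoint reduced (p : seq V) : Prop :=
  if p is v :: t then (forall q, ~ Del v t q) /\ reduced t else True.

(** A ladder from either new edge of the flipped square would shorten or prolong to a ladder from
    the parallel old edge. *)
Lemma reduced_flip p p' : flip p p' -> reduced p -> reduced p'.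
Proof.
elim=> {p p'} [a b c d t hs|x p p' hf IH] /=.
  move=> [h1 [h2 h3]]; split; last split=> // q hq.
    move=> q /Del_inv [[e _]|[w' [q' [h4 h5 _]]]]; first by case: (Sq_neq_diag HX hs).
    apply: (h2 q'); suff -> : b = w' by [].
    by apply: (Sq_uniq HX _ h4); apply: Sq_flip => //; apply: Sq_swap.
  by apply: (h1 (a :: q)); apply: Del_sq hq; apply: Sq_flip.
move=> [h1 h2]; split; last exact: IH.
by move=> q /(Del_flip (flip_sym hf)) [q' /h1].
Qed.

Lemma reduced_feq p p' : feq p p' -> reduced p <-> reduced p'.
Proof.
elim=> {p p'} [p p' h|//|p p' _ [h1 h2]|p p' p'' _ [h1 h2] _ [h3 h4]].
- by split; apply: reduced_flip => //; apply: flip_sym.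
- by split.
- by split; [move/h1|move/h4].
Qed.

Definition step (p : seq V) (w : V) : seq V :=
  if excluded_middle_informative (exists q, Del w p q) is left h
  then proj1_sig (constructive_indefinite_description _ h) else w :: p.

Lemma stepP p w : Del w p (step p w) \/ (forall q, ~ Del w p q) /\ step p w = w :: p.
Proof.
rewrite /step; case: excluded_middle_informative => h; last by right; split=> // q hq; case: h; exists q.
by left; case: constructive_indefinite_description.
Qed.

Lemma step_Del p w q : Del w p q -> step p w = q.
Proof.
move=> h; case: (stepP p w) => [h'|[h' _]]; first exact: Del_fun h' h.
by case: (h' _ h).
Qed.

Lemma step_noDel p w : (forall q, ~ Del w p q) -> step p w = w :: p.
Proof. by move=> h; case: (stepP p w) => [/h|[_ ->]]. Qed.

Lemma step_head p w : exists t, step p w = w :: t.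
Proof. by case: (stepP p w) => [/Del_head [t ->]|[_ ->]]; eexists. Qed.

Lemma step_feq p p' w : feq p p' -> feq (step p w) (step p' w).
Proof.
move=> h; case: (stepP p w) => [h1|[h1 ->]].
  by have [q' /step_Del ->] := Del_feq h h1.
rewrite step_noDel; first exact: feq_cons.
by move=> q /(Del_feq (feq_sym h)) [q' /h1].
Qed.

Lemma step_reduced p w : reduced p -> reduced (step p w).
Proof.
case: (stepP p w) => [h1|[h1 ->]]; last by split.
case: p h1 => [|v t] h1 h2; first by inversion h1.
by have [_] := proj2 (reduced_feq (Del_back h1)) h2.
Qed.

(** Either the first step cancels, and reducedness keeps the way back from cancelling, or it extends
    the path and the way back cancels at once. *)
Lemma step_back v t w : reduced (v :: t) -> feq (step (step (v :: t) w) v) (v :: t).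
Proof.
move=> hr; case: (stepP (v :: t) w) => [h|[h ->]]; last first.
  by rewrite (step_Del (Del_hit _ _ _)); apply: feq_refl.
rewrite step_noDel; first exact: Del_back h.
by have [] := proj2 (reduced_feq (Del_back h)) hr.
Qed.

(** The cases are whether the edges from [v] to [a] and to [b] cancel. If both do, so do the two
    edges into [d]; if only one does, its parallel in the square cancels too and the fourth edge
    does not; if neither does, the results differ by a flip. *)
Lemma step_square v t a b d : reduced (v :: t) -> Sq v a b d ->
  feq (step (step (v :: t) a) d) (step (step (v :: t) b) d).
Proof.
have mixed a' b' q : reduced (v :: t) -> Sq v a' b' d -> Del a' (v :: t) q ->
    (forall q, ~ Del b' (v :: t) q) ->
    feq (step q d) (step (b' :: v :: t) d).
  move=> hr hs ha hb; rewrite (step_Del (Del_sq (Sq_swap HX (Sq_flip HX (Sq_swap HX hs))) ha)).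
  rewrite step_noDel; first exact: feq_refl.
  have [q' e] := Del_head ha; subst q.
  move=> r hd; have hb' : Del b' (v :: a' :: q') (b' :: r).
    by apply: Del_sq hd; apply: Sq_swap.
  by have [r' /hb] := Del_feq (Del_back ha) hb'.
move=> hr hs; case: (stepP (v :: t) a) => [ha|[ha ->]]; case: (stepP (v :: t) b) => [hb|[hb ->]].
- move: ha hb; move: (step _ a) (step _ b) => qa qb ha hb.
  have [qa' e] := Del_head ha; subst qa.
  have [r hr' e2] := Del_feq (feq_sym (Del_back ha)) hb.
  case/Del_inv: hr' => [[e _]|[w' [s [h1 h2 e]]]]; first by case: (Sq_neq HX hs).
  subst r.
  have e := Sq_uniq HX h1 (Sq_swap HX hs); subst w'.
  have [s' e] := Del_head h2; subst s.
  rewrite (step_Del h2); apply: feq_sym; apply: feq_trans (step_feq d e2) _.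
  by rewrite (step_Del (Del_hit _ _ _)); apply: feq_refl.
- exact: (mixed a b).
- by apply: feq_sym; apply: (mixed b a) => //; apply: Sq_swap.
- rewrite step_noDel; last first.
    move=> q /Del_inv [[e _]|[w' [s [h1 h2 _]]]]; first by case: (Sq_neq_diag HX hs).
    apply: (hb s); suff -> : b = w' by [].
    exact: (Sq_uniq HX (Sq_swap HX (Sq_flip HX hs)) h1).
  rewrite step_noDel; last first.
    move=> q /Del_inv [[e _]|[w' [s [h1 h2 _]]]]; first by case: (Sq_neq_diag HX hs).
    apply: (ha s); suff -> : a = w' by [].
    exact: (Sq_uniq HX (Sq_swap HX (Sq_flip HX (Sq_swap HX hs))) h1).
  by apply: rst_step; apply: flip_here; exact: (Sq_flip HX (Sq_swap HX (Sq_flip HX hs))).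
Qed.

Definition nf : seq V -> seq V := foldl step [::].

Lemma foldl_step_feq l p p' : feq p p' -> feq (foldl step p l) (foldl step p' l).
Proof. by elim: l p p' => //= x l IH p p' h; apply: IH; apply: step_feq. Qed.

Lemma foldl_step_reduced l p : reduced p -> reduced (foldl step p l).
Proof. by elim: l p => //= x l IH p h; apply: IH; apply: step_reduced. Qed.

Lemma nf_hmove l l' : hmove X l l' -> feq (nf l) (nf l').
Proof.
case=> [s t u v _|s t q hq]; rewrite /nf !foldl_cat /=.
all: have := foldl_step_reduced s (I : reduced [::]); move: (foldl _ _ _) => p hp; apply: foldl_step_feq.
  have := step_reduced u hp; have [r ->] := step_head p u; exact: step_back.
have := step_reduced (q c00) hp; have [r ->] := step_head p (q c00) => hr.
by apply: step_square => //; exists q.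
Qed.

Lemma nf_homotopic l l' : homotopic X l l' -> feq (nf l) (nf l').
Proof.
elim=> [p q /nf_hmove //|p|p q _ h|p q r _ h1 _ h2].
- exact: feq_refl.
- exact: feq_sym.
- exact: feq_trans h2.
Qed.

(** Both moves preserve the parity of the length; this will make the 1-skeleton bipartite. *)
Lemma odd_homotopic l l' : homotopic X l l' -> odd (size l) = odd (size l').
Proof.
elim=> [p q []|//|//|p q r _ -> _ ->//] *.
  by rewrite !size_cat /= !oddD /= negbK.
by rewrite !size_cat.
Qed.

Lemma foldl_step_size l p : size (foldl step p l) <= size p + size l.
Proof.
elim: l p => [|x l IH] p /=; first by rewrite addn0.
apply: leq_trans (IH _) _; rewrite addnS -addSn leq_add2r.
by case: (stepP p x) => [/Del_size ->|[_ ->]] //; lia.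
Qed.

Lemma foldl_step_back p l v : reduced (v :: p) ->
  feq (foldl step (foldl step (v :: p) l) (behead (rev (v :: l)))) (v :: p).
Proof.
elim: l v p => [|x l IH] v p hr /=; first exact: feq_refl.
have hr' := step_reduced x hr; have [r e] := step_head (v :: p) x.
move: hr'; rewrite e => hr'.
have -> : behead (rev [:: v, x & l]) = rcons (behead (rev (x :: l))) v.
  rewrite rev_cons; case E: (rev (x :: l)) => [|y m] //.
  by move: (congr1 size E); rewrite size_rev.
rewrite -cats1 foldl_cat /=; apply: feq_trans (step_feq v (IH _ _ hr')) _.
by rewrite -e; apply: step_back.
Qed.

End NormalForms.

(** * Walks and distances for an arbitrary relation *)

Section Walks.
Variables (T : Type) (r : T -> T -> Prop).

Lemma walk_refl x : walk r x x 0.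
Proof. by exists (fun=> x). Qed.

Lemma walk_cons x y z n : r x y -> walk r y z n -> walk r x z n.+1.
Proof.
move=> h [f [f0 [fn hf]]]; exists (fun i => if i is j.+1 then f j else x); split=> //; split=> //.
by case=> [_|i hi]; [rewrite f0|apply: hf].
Qed.

Lemma walk_inv x z n : walk r x z n.+1 -> exists2 y, r x y & walk r y z n.
Proof.
move=> [f [<- [<- hf]]]; exists (f 1); first exact: hf.
by exists (fun i => f i.+1); split=> //; split=> // i hi; apply: hf.
Qed.

Lemma walk_inv0 x y : walk r x y 0 -> x = y.
Proof. by move=> [f [<- [<- _]]]. Qed.

Lemma walk_cat x y z m n : walk r x y m -> walk r y z n -> walk r x z (m + n).
Proof.
elim: m x => [|m IH] x; first by move/walk_inv0 ->.
by move=> /walk_inv [w hw h] h'; apply: walk_cons hw _; apply: IH.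
Qed.

Lemma walk1 x y : r x y -> walk r x y 1.
Proof. by move=> h; apply: walk_cons h (walk_refl y). Qed.

Lemma walk_sym x y n : (forall a b, r a b -> r b a) -> walk r x y n -> walk r y x n.
Proof.
move=> hs; elim: n x => [|n IH] x; first by move/walk_inv0 ->; apply: walk_refl.
move=> /walk_inv [w hw h]; rewrite -addn1; apply: walk_cat (IH _ h) _.
by apply: walk1; apply: hs.
Qed.

Lemma is_dist_fun x y m n : is_dist r x y m -> is_dist r x y n -> m = n.
Proof.
by move=> [h1 h2] [h3 h4]; apply/eqP; rewrite eqn_leq h2 // h4.
Qed.

Lemma is_dist_ex x y n : walk r x y n -> exists2 m, is_dist r x y m & m <= n.
Proof.
elim/ltn_ind: n => n IH h.
case: (classic (exists2 m, m < n & walk r x y m)) => [[m lt /IH [//|k hk le]]|hn].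
  by exists k => //; apply: leq_trans le (ltnW lt).
exists n => //; split=> // m hm; rewrite leqNgt; apply/negP => lt.
by apply: hn; exists m.
Qed.

End Walks.

Lemma walk_map (T U : Type) (r : T -> T -> Prop) (s : U -> U -> Prop) (f : T -> U) x y n :
  (forall a b, r a b -> s (f a) (f b)) -> walk r x y n -> walk s (f x) (f y) n.
Proof.
move=> h; elim: n x => [|n IH] x; first by move=> w; rewrite (walk_inv0 w); apply: walk_refl.
by move=> wk; have [w hw hx] := walk_inv wk; apply: walk_cons (IH _ hx); apply: h.
Qed.

(** * The metric of the 1-skeleton and the quadrangle condition *)

Section Distance.
Variables (V : Type) (X : cube_complex V).
Hypothesis HX : CAT0_cube_complex X.
Local Notation Sq := (Sq X).
Local Notation adj := (adj X).

Definition dist (u v : V) : nat := epsilon (inhabits 0%N) (is_dist adj u v).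

Lemma dist_spec u v : is_dist adj u v (dist u v).
Proof.
apply: epsilon_spec; case: HX => _ [[h _] _]; have [n hn] := h u v.
by have [m hm _] := is_dist_ex hn; exists m.
Qed.

Lemma is_distE u v n : is_dist adj u v n <-> dist u v = n.
Proof. by split=> [|<-]; [apply: is_dist_fun|]; apply: dist_spec. Qed.

Lemma dist_walk u v : walk adj u v (dist u v).
Proof. by have [] := dist_spec u v. Qed.

Lemma dist_min u v n : walk adj u v n -> dist u v <= n.
Proof. by have [_ h] := dist_spec u v; apply: h. Qed.

Lemma distxx u : dist u u = 0.
Proof. by apply/eqP; rewrite -leqn0; apply: dist_min; apply: walk_refl. Qed.

Lemma dist_eq0 u v : dist u v = 0 -> u = v.
Proof. by move=> e; have w := dist_walk u v; rewrite e in w; exact: walk_inv0 w. Qed.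

Lemma distC u v : dist u v = dist v u.
Proof.
by apply/eqP; rewrite eqn_leq !dist_min //; apply: walk_sym (dist_walk _ _) => a b; apply: adj_sym.
Qed.

Lemma dist_triangle u v w : dist u w <= dist u v + dist v w.
Proof. by apply: dist_min; apply: walk_cat; apply: dist_walk. Qed.

Lemma dist_adj u v : adj u v -> dist u v = 1.
Proof.
move=> h; have := dist_min (walk1 h); case E: (dist u v) => [|[|//]] //.
by case: (adj_neq HX h); apply: dist_eq0.
Qed.

Lemma adj_dist u v : dist u v = 1 -> adj u v.
Proof. by move=> e; have w := dist_walk u v; rewrite e in w; have [a h w'] := walk_inv w; rewrite -(walk_inv0 w'). Qed.

Lemma dist_step u v n : dist u v = n.+1 -> exists2 w, adj u w & dist w v = n.
Proof.
move=> e; have wk := dist_walk u v; rewrite e in wk; have [w hw h] := walk_inv wk; exists w => //.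
have := dist_min h; have := dist_triangle u w v; rewrite (dist_adj hw); lia.
Qed.

Lemma epath_cat x p q : epath X (x :: p) -> epath X (last x p :: q) -> epath X (x :: p ++ q).
Proof. by elim: p x => //= y p IH x [h1 h2] h3; split=> //; apply: IH. Qed.

Lemma epath_rev x p : epath X (x :: p) -> epath X (rev (x :: p)).
Proof.
elim: p x => // y p IH x [h1 h2]; rewrite rev_cons -cats1.
have := IH _ h2; rewrite lastI rev_rcons => /epath_cat; apply.
have -> : last (last y p) (rev (belast y p)) = y.
  by rewrite -[LHS](last_cons (last y p)) -rev_rcons -lastI rev_cons last_rcons.
by split=> //; apply: adj_sym.
Qed.

Lemma walk_epath x y n : walk adj x y n -> exists p, [/\ epath X (x :: p), last x p = y & size p = n].
Proof.
elim: n x => [|n IH] x; first by move=> wk; rewrite (walk_inv0 wk); exists [::].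
by move=> wk; have [w hw /IH [p [h1 h2 h3]]] := walk_inv wk; exists (w :: p); rewrite /= h3.
Qed.

Lemma epath_walk x p : epath X (x :: p) -> walk adj x (last x p) (size p).
Proof.
elim: p x => [|y p IH] x /=; first by move=> _; apply: walk_refl.
by move=> [h /IH]; apply: (walk_cons h).
Qed.

Lemma Del_epath w v t q : Del X w (v :: t) q -> adj v w -> epath X (v :: t) ->
  epath X q /\ last w q = last v t.
Proof.
move=> h; move: {1 2}(v :: t) h (erefl (v :: t)) => p h.
elim: h v t => {w p q} [v0 w t0|v0 v' w w' t0 q hs hd IH] v t [<- <-] ha; first by case.
move=> [h1 h2]; have aw : adj v' w'.
  by apply: (Sq_adj HX (Sq_swap HX (Sq_flip HX (Sq_swap HX hs)))).
have [h3 h4] := IH v' t0 erefl aw h2; have [q1 e] := Del_head hd; subst q.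
split; last by rewrite /= in h4 *.
by split=> //; apply: (Sq_adj HX (Sq_swap HX (Sq_flip HX hs))).
Qed.

Lemma step_epath w v t : adj v w -> epath X (v :: t) ->
  exists t', [/\ step X (v :: t) w = w :: t', epath X (w :: t') & last w t' = last v t].
Proof.
move=> ha hp; case: (stepP X (v :: t) w) => [h|[_ ->]]; last first.
  by exists (v :: t); split=> //; split=> //; apply: adj_sym.
have [h1 h2] := Del_epath h ha hp; have [t' e] := Del_head h.
by exists t'; rewrite e in h1 h2 *.
Qed.

Lemma foldl_step_epath l v t : epath X (v :: l) -> epath X (v :: t) ->
  exists t', [/\ foldl (step X) (v :: t) l = last v l :: t', epath X (last v l :: t')
     & last (last v l) t' = last v t].
Proof.
elim: l v t => [|w l IH] v t /=; first by move=> _ h; exists t.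
move=> [h1 h2] h3; have [t' [-> h4 <-]] := step_epath h1 h3.
exact: IH.
Qed.

Lemma nf_cons u p : nf X (u :: p) = foldl (step X) [:: u] p.
Proof. by rewrite /nf /= step_noDel // => q h; inversion h. Qed.

(** The loop along [p] and back along [q] is contractible, so its normal form is trivial. Following
    [q] from there gives the normal form of [q], while cancelling [q] against the way back gives
    that of [p]. *)
Lemma nf_endpoints u p q : epath X (u :: p) -> epath X (u :: q) -> last u p = last u q ->
  feq X (nf X (u :: p)) (nf X (u :: q)).
Proof.
move=> hp hq e; pose b := rev (belast u q).
have eb : rev (u :: q) = last u q :: b by rewrite lastI rev_rcons.
have hloop : epath X (u :: p ++ b).
  by apply: epath_cat => //; rewrite e -eb; apply: epath_rev.
have lloop : last u (p ++ b) = u.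
  by rewrite last_cat e -[LHS](last_cons (last u q)) -eb rev_cons last_rcons.
case: (HX) => _ [[_ sc] _].
have h1 := nf_homotopic HX (sc _ _ hloop lloop); rewrite !nf_cons foldl_cat /= in h1.
rewrite !nf_cons; apply: feq_trans (foldl_step_feq HX q h1).
have [t [et _ _]] := foldl_step_epath hp (I : epath X [:: u]).
have rt : reduced X (last u p :: t).
  rewrite -et; apply: foldl_step_reduced => //=; split=> // r h; inversion h.
have := foldl_step_back HX b rt.
have -> : behead (rev (last u p :: b)) = q by rewrite e -eb revK.
by rewrite et => /feq_sym.
Qed.

Lemma foldl_step_max l p : size (foldl (step X) p l) = size p + size l ->
  foldl (step X) p l = rev l ++ p.
Proof.
elim: l p => //= x l IH p; rewrite rev_cons cat_rcons.
case: (stepP X p x) => [hd|[_ ->]] h; last by apply: IH => /=; rewrite h addnS.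
have := Del_size hd.
by have := foldl_step_size X l (step X p x); lia.
Qed.

(** A cancellation would leave an edge path with the same ends, shorter than the geodesic. *)
Lemma nf_geodesic u p : epath X (u :: p) -> size p = dist u (last u p) ->
  nf X (u :: p) = rev (u :: p).
Proof.
move=> hp e; rewrite nf_cons rev_cons -cats1; apply: foldl_step_max.
have [t [et h1 h2]] := foldl_step_epath hp (I : epath X [:: u]).
have := foldl_step_size X p [:: u]; rewrite et /=.
have := dist_min (epath_walk h1); rewrite h2 /= distC; lia.
Qed.

(** The geodesics from [z] to [y] through [x] and through [x'] are their own normal forms, so they
    agree up to flips. The edge from [y] to [x'] cancels against the second, hence along a ladder
    against the first; the first square of this ladder is the one sought, and the rest of it leaves
    a short path to [p]. *)
Lemma quadrangle z y x x' : adj y x -> adj y x' -> x <> x' ->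
  dist z x < dist z y -> dist z x' < dist z y ->
  exists2 p, Sq y x x' p & dist z p < dist z x.
Proof.
have ext a : adj y a -> dist z a < dist z y -> exists p, [/\ epath X (z :: rcons p y),
    last z p = a, size p = dist z a & (size p).+1 = dist z y].
  move=> ha hd; have [p [h1 h2 h3]] := walk_epath (dist_walk z a).
  exists p; split=> //.
    by rewrite -cats1; apply: epath_cat => //; rewrite h2; split=> //; apply: adj_sym.
  have := dist_triangle z a y; rewrite h3 (dist_adj (adj_sym HX ha)); lia.
move=> ax ax' nx /(ext _ ax) [p [hp lp sp dp]] /(ext _ ax') [p' [hp' lp' sp' dp']].
have := nf_endpoints hp hp'; rewrite !last_rcons => /(_ erefl).
rewrite !nf_geodesic ?size_rcons ?last_rcons // -!rcons_cons !rev_rcons => hf.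
have rev_z a s : last z s = a -> exists t, rev (z :: s) = a :: t.
  by move=> <-; rewrite lastI rev_rcons; eexists.
have [s es] := rev_z x p lp; have [s' es'] := rev_z x' p' lp'; rewrite es es' in hf.
have [q hd _] := Del_feq HX (feq_sym hf) (Del_hit X y x' s').
have [[e _]|[w [q' [h1 h2 _]]]] := Del_inv hd; first by case: nx.
exists w; first exact: Sq_swap.
have ep : epath X (x :: s).
  rewrite -es; apply: epath_rev; move: hp; rewrite -cats1.
  by elim: (p) (z) => //= b l IH c [h3 h4]; split=> //; apply: IH.
have [h3 h4] := Del_epath h2 (Sq_adj HX (Sq_swap HX (Sq_flip HX (Sq_swap HX h1)))) ep.
have [q1 e1] := Del_head h2; subst q'.
have := dist_min (epath_walk h3); have := Del_size h2; rewrite -es size_rev /= in h4 *.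
have -> : last w q1 = z.
  by rewrite h4 -[LHS](last_cons x) -es rev_cons last_rcons.
rewrite distC; lia.
Qed.

(** Otherwise two geodesics and the edge would form a closed path of odd length, against parity
    under homotopy. *)
Lemma dist_adj_step z x y : adj x y -> dist z x = (dist z y).+1 \/ dist z y = (dist z x).+1.
Proof.
move=> h; have := dist_triangle z x y; have := dist_triangle z y x.
rewrite (distC y x) (dist_adj h).
suff : dist z x <> dist z y by lia.
move=> e; have [p [h1 h2 h3]] := walk_epath (dist_walk z x).
have [q [h4 h5 h6]] := walk_epath (dist_walk y z).
case: (HX) => _ [[_ sc] _].
have hl : epath X (z :: p ++ y :: q) by apply: epath_cat => //; rewrite h2.
have := odd_homotopic (sc _ _ hl _); rewrite last_cat /= => /(_ h5).
by rewrite size_cat /= h3 h6 (distC y) e addnS /= negbK addnn odd_double.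
Qed.

End Distance.

(** * Hyperplanes through their halfspaces; convexity and separation *)

Section Walls.
Variables (V : Type) (X : cube_complex V).
Hypothesis HX : CAT0_cube_complex X.
Local Notation Sq := (Sq X).
Local Notation adj := (adj X).
Local Notation dist := (dist X).

Definition W (x y z : V) : bool := dist z x < dist z y.

(** A wall is a hyperplane with a chosen side, given by the indicator of that halfspace; [equivw]
    forgets the side, and [hyp] recovers the dual edges. *)
Definition wall (h : V -> bool) : Prop := exists x y, adj x y /\ h =1 W x y.

Definition hyp (h : V -> bool) (a b : V) : Prop := adj a b /\ h a <> h b.

Definition equivw (h k : V -> bool) : Prop := h =1 k \/ h =1 (fun z => ~~ k z).

Lemma W_compl x y z : adj x y -> W y x z = ~~ W x y z.
Proof. by move=> h; have := dist_adj_step HX z h; rewrite /W; lia. Qed.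

Lemma Wl x y : adj x y -> W x y x.
Proof. by move=> h; rewrite /W distxx // dist_adj. Qed.

Lemma Wr x y : adj x y -> W x y y = false.
Proof. by move=> h; rewrite /W [dist y y]distxx. Qed.

Lemma wall_W x y : adj x y -> wall (W x y).
Proof. by exists x, y. Qed.

(** If [z] were on different sides, [quadrangle] at a corner farthest from [z] would give a square
    closing nearer to [z], while uniqueness makes its last corner the other farthest one. *)
Lemma W_sq x y x' y' : Sq x y x' y' -> W x y =1 W x' y'.
Proof.
have half a b a' b' z : Sq a b a' b' -> W a b z -> W a' b' z.
  move=> hs; rewrite /W => h1; case: ltnP => // h2.
  have ab := Sq_adj HX hs; have ab' := Sq_adj HX (Sq_flip HX (Sq_swap HX (Sq_flip HX hs))).
  have aa' := Sq_adj HX (Sq_swap HX hs); have bb' := Sq_adj HX (Sq_swap HX (Sq_flip HX hs)).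
  have e1 := dist_adj_step HX z ab; have e2 := dist_adj_step HX z ab'.
  have e3 := dist_adj_step HX z aa'; have e4 := dist_adj_step HX z bb'.
  have [||p hp lt] := @quadrangle _ _ HX z b a b' (adj_sym HX ab) bb' (Sq_neq HX (Sq_flip HX hs)).
  - lia.
  - lia.
  have ep := Sq_uniq HX hp (Sq_flip HX hs); subst p.
  lia.
move=> hs z; apply/idP/idP; first exact: half hs.
by apply: half; apply: Sq_swap => //; apply: Sq_flip => //; apply: Sq_swap.
Qed.

(** Induction on the distance from [a] to [x]: a step [a'] towards [x] and the edge to [b] both
    approach [y], so [quadrangle] gives a square in which the parallel edge at [a'] is nearer to
    [x]. *)
Lemma W_edge x y a b : adj x y -> adj a b -> W x y a -> ~~ W x y b ->
  clos_refl_sym_trans _ (par1 X) (x, y) (a, b) /\ W a b =1 W x y.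
Proof.
move=> axy; move: {2}(dist a x) (erefl (dist a x)) => n; elim: n a b => [|n IH] a b en ab ha hb.
  have e := dist_eq0 HX en; subst a.
  have e : b = y.
    apply: (dist_eq0 HX); move: hb; rewrite /W (dist_adj HX (adj_sym HX ab)).
    by have := dist_adj_step HX b axy; rewrite (dist_adj HX (adj_sym HX ab)); lia.
  by subst b; split=> //; apply: rst_refl.
have [a' aa' ea'] := dist_step HX en.
have s1 := dist_adj_step HX a axy; have s2 := dist_adj_step HX b axy.
have s3 := dist_adj_step HX x ab; have s4 := dist_adj_step HX y ab.
have s5 := dist_adj_step HX y aa'; have s6 := dist_adj_step HX a' axy.
have h1 := ha; have h2 := hb; rewrite /W in h1 h2.
rewrite !(distC HX x) !(distC HX y) in s3 s4 s5.
have na : a' <> b by move=> e; subst b; lia.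
have [||p hp lt] := @quadrangle _ _ HX y a a' b aa' ab na.
- rewrite !(distC HX y); lia.
- rewrite !(distC HX y); lia.
rewrite !(distC HX y) in lt.
have pb := Sq_adj HX (Sq_swap HX (Sq_flip HX (Sq_swap HX hp))).
have a'p := Sq_adj HX (Sq_swap HX (Sq_flip HX hp)).
have s7 := dist_adj_step HX x pb; have s8 := dist_adj_step HX y a'p.
rewrite !(distC HX x) !(distC HX y) in s7 s8.
have [||p1 p2] := IH a' p ea' a'p; [by rewrite /W; lia|by rewrite /W; lia|].
have hp' := Sq_swap HX hp.
split; last by move=> z; rewrite (W_sq hp' z) p2.
apply: rst_trans p1 _; apply: rst_sym; apply: rst_step.
by case: hp' => q [hq <- <- <- <-]; apply: par_sq.
Qed.

Lemma wall_edge h a b : wall h -> adj a b -> h a -> ~~ h b -> h =1 W a b.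
Proof.
move=> [x [y [axy e]]] ab; rewrite !e => ha hb.
by have [_ e'] := W_edge axy ab ha hb; move=> z; rewrite e e'.
Qed.

Lemma wall_edge_equiv h a b : wall h -> adj a b -> h a <> h b -> equivw h (W a b).
Proof.
move=> hw ab; case ha: (h a); case hb: (h b) => // _; first by left; apply: wall_edge; rewrite ?hb.
right=> z; rewrite -W_compl //; apply: wall_edge => //; rewrite ?ha //; exact: adj_sym.
Qed.

Lemma equivw_sym h k : equivw h k -> equivw k h.
Proof. by case=> e; [left|right] => z; rewrite e ?negbK. Qed.

Lemma equivw_trans h k l : equivw h k -> equivw k l -> equivw h l.
Proof.
by case=> e [] e'; [left|right|right|left] => z; rewrite e e' ?negbK.
Qed.

Lemma equivw_eq h k p q : equivw h k -> (h p = h q) <-> (k p = k q).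
Proof. by case=> e; rewrite !e //; split=> [/negb_inj|->]. Qed.

Lemma wall_edge2 h k a b : wall h -> wall k -> adj a b -> h a <> h b -> k a <> k b -> equivw h k.
Proof.
move=> hh hk ab h1 h2; apply: (equivw_trans (wall_edge_equiv hh ab h1)).
by apply: equivw_sym; apply: wall_edge_equiv.
Qed.

Lemma rel_ext (R S : V -> V -> Prop) : (forall a b, R a b <-> S a b) -> R = S.
Proof.
move=> h; apply: functional_extensionality => a; apply: functional_extensionality => b.
exact: propositional_extensionality.
Qed.

Lemma hyp_equiv h k : equivw h k -> hyp h = hyp k.
Proof.
by move=> e; apply: rel_ext => a b; split=> -[ab n]; split=> // e'; apply: n; apply/(equivw_eq _ _ e).
Qed.

Lemma hyp_inj h k : wall h -> wall k -> hyp h = hyp k -> equivw h k.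
Proof.
move=> hh hk e; have [x [y [axy e1]]] := hh.
have n : h x <> h y by rewrite !e1 Wl // Wr.
have : hyp h x y by [].
by rewrite e => -[_ n']; apply: wall_edge2 n n'.
Qed.

Lemma par1_W e e' : clos_refl_sym_trans _ (par1 X) e e' ->
  (adj e.1 e.2 <-> adj e'.1 e'.2) /\ (adj e.1 e.2 -> equivw (W e.1 e.2) (W e'.1 e'.2)).
Proof.
elim=> {e e'} [e e'|e|e e' _ [h1 h2]|e e' e'' _ [h1 h2] _ [h3 h4]].
- case=> [u v a|q hq] /=.
    split; first by split=> _ //; apply: adj_sym.
    by right=> z; apply: W_compl; apply: adj_sym.
  have hs : Sq (q c00) (q c10) (q c01) (q c11) by exists q.
  split; last by left; apply: W_sq.
  split=> _; last exact: Sq_adj hs.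
  exact: (Sq_adj HX (Sq_swap HX (Sq_flip HX (Sq_swap HX hs)))).
- by split=> // _; left.
- by split; [split; apply h1|move=> a; apply: equivw_sym; apply: h2; apply/h1].
- split; first by rewrite h1.
  by move=> a; apply: equivw_trans (h2 a) (h4 _); apply/h1.
Qed.

Lemma par_hyp x y a b : adj x y ->
  clos_refl_sym_trans _ (par1 X) (x, y) (a, b) <-> hyp (W x y) a b.
Proof.
move=> axy; split=> [h|[ab n]].
  have [/= h1 h2] := par1_W h; have ab : adj a b by apply/h1.
  by split=> //; rewrite (equivw_eq _ _ (h2 axy)) Wl // Wr.
case ha: (W x y a); case hb: (W x y b); rewrite ha hb // in n.
  by have [] := W_edge axy ab ha (negbT hb).
have [h _] := W_edge axy (adj_sym HX ab) hb (negbT ha).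
by apply: rst_trans h _; apply: rst_step; apply: par_rev; apply: adj_sym.
Qed.

Lemma hyperplaneP H : hyperplane X H <-> exists h, wall h /\ H = hyp h.
Proof.
split=> [[x [y [a h]]]|[h [[x [y [a e]]] ->]]].
  by exists (W x y); split; [apply: wall_W|apply: rel_ext => u v; rewrite h par_hyp].
have -> : hyp h = hyp (W x y) by apply: hyp_equiv; left.
by exists x, y; split=> // u v; rewrite par_hyp.
Qed.

Lemma hyperplane_hyp h : wall h -> hyperplane X (hyp h).
Proof. by move=> hh; apply/hyperplaneP; exists h. Qed.

Lemma wall_closer h b x z : wall h -> adj x z -> h x <> h z -> h b = h z -> dist b z < dist b x.
Proof.
move=> hh a n e; have := wall_edge_equiv hh a n; move/(equivw_eq b z); rewrite e.
move=> [/(_ erefl) h1 _]; move: h1; rewrite Wr // => /negbT; rewrite -W_compl //.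
Qed.

(** As [q] lies beyond both edges, [x] and [y] are nearer to [q] than [w] is, and [quadrangle]
    applies. This is the tool that builds half-flats square by square. *)
Lemma wall_square h k w x y q : wall h -> wall k -> adj w x -> adj w y -> x <> y ->
  h x <> h w -> k y <> k w -> h q = h x -> k q = k y -> exists z, Sq w x y z.
Proof.
move=> hh hk ax ay nxy nx ny e1 e2.
have [|||p hp _] := @quadrangle _ _ HX q w x y ax ay; last by exists p.
- by [].
- by apply: (wall_closer hh ax) => // e; apply: nx.
- by apply: (wall_closer hk ay) => // e; apply: ny.
Qed.

Lemma Sq_wall k w x y z : wall k -> Sq w x y z -> (k z != k x) = (k y != k w).
Proof.
move=> hk hs.
have half a b a' b' : Sq a b a' b' -> k a <> k b -> k a' <> k b'.
  move=> h n; have := wall_edge_equiv hk (Sq_adj HX h) n.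
  have -> : equivw k (W a b) <-> equivw k (W a' b').
    have e : equivw (W a b) (W a' b') by left; apply: W_sq.
    by split=> h'; apply: equivw_trans h' _ => //; apply: equivw_sym.
  move=> e; rewrite (equivw_eq _ _ e).
  have a1 := Sq_adj HX (Sq_swap HX (Sq_flip HX (Sq_swap HX h))).
  by rewrite Wl // Wr.
apply/idP/idP => /eqP n; apply/eqP => e.
  have := half x z w y; case=> //; last by move=> e'; apply: n.
  by apply: Sq_swap => //; apply: Sq_flip.
by apply: (half w y x z) => //; [apply: Sq_swap|move=> e'; apply: n].
Qed.

Lemma walk_cross (r : V -> V -> Prop) (h : V -> bool) u v n : walk r u v n -> h u <> h v ->
  exists a b i j, [/\ r a b, walk r u a i, walk r b v j, (i + j).+1 = n & h a = h u /\ h b = h v].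
Proof.
elim: n u => [|n IH] u wk hn; first by case: hn; rewrite (walk_inv0 wk).
have [w uw wk'] := walk_inv wk; case: (eqVneq (h w) (h v)) => [e|/eqP ne].
  by exists u, w, 0, n; split=> //; apply: walk_refl.
have [a [b [i [j [h1 h2 h3 h4 [h5 h6]]]]]] := IH _ wk' ne.
exists a, b, i.+1, j; split=> //; [exact: walk_cons h2|by rewrite addSn h4|split=> //].
by rewrite h5; move: hn ne; case: (h u); case: (h v); case: (h w).
Qed.

(** If the geodesic left the halfspace along an edge from [a] to [b], then [b] would be nearer to
    [w] than [a], although [w] lies on the side of [a]. *)
Lemma wall_convex h u p w : wall h -> dist u p + dist p w = dist u w -> h u = h w -> h p = h u.
Proof.
move=> hh e euw; apply/eqP; apply: contraT => /eqP n.
have [|a [b [i [j [ab wa wb eij [ea eb]]]]]] := walk_cross (h := h) (dist_walk HX u p).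
  by move=> e'; apply: n.
have lt : dist w a < dist w b.
  apply: (wall_closer hh (adj_sym HX ab)); last by rewrite ea.
  by rewrite ea eb; apply: n.
have := dist_min HX wa; have := dist_min HX wb; have := dist_triangle HX u a w.
have := dist_triangle HX b p w; rewrite (distC HX a w) (distC HX b w).
have := dist_triangle HX u b w; have := dist_triangle HX u a b; rewrite (dist_adj HX ab) (distC HX b w).
lia.
Qed.

Lemma walk_geod u w n : walk adj u w n -> dist u w = n ->
  walk (fun a b => adj a b /\ (dist u a + dist a w = dist u w /\ dist u b + dist b w = dist u w)) u w n.
Proof.
move=> [f [<- [<- hf]]] e; exists f; split=> //; split=> //.
have on i : i <= n -> dist (f 0) (f i) + dist (f i) (f n) = dist (f 0) (f n).
  move=> hi; have w1 : walk adj (f 0) (f i) i.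
    by exists f; split=> //; split=> // j hj; apply: hf; apply: leq_trans hi.
  have w2 : walk adj (f i) (f n) (n - i).
    exists (fun j => f (i + j)); rewrite addn0 subnKC //; split=> //; split=> // j hj.
    by rewrite addnS; apply: hf; lia.
  have := dist_min HX w1; have := dist_min HX w2; have := dist_triangle HX (f 0) (f i) (f n); lia.
by move=> i hi; split; [apply: hf|split; apply: on; [apply: ltnW|]].
Qed.

Lemma walk_sub (r s : V -> V -> Prop) u w n : (forall a b, r a b -> s a b) -> walk r u w n -> walk s u w n.
Proof. by move=> h; apply: (walk_map (f := id)). Qed.

Lemma halfsame_hyp h u w : wall h -> h u = h w -> halfsame X (hyp h) u w.
Proof.
move=> hh e; exists (dist u w).
apply: walk_sub (walk_geod (dist_walk HX u w) erefl) => a b [ab [e1 e2]]; split=> // -[_]; apply.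
by rewrite (wall_convex hh e1 e) (wall_convex hh e2 e).
Qed.

Lemma cross_hyp h k : wall h -> wall k -> (forall s t, exists p, h p = s /\ k p = t) ->
  cross X (hyp h) (hyp k).
Proof.
move=> hh hk hq.
have ex l : wall l -> exists x y, [/\ hyp l x y, l x = true & l y = false].
  by move=> [x [y [a e]]]; exists x, y; rewrite /hyp !e Wl // Wr.
have [x [y [h1 h2 h3]]] := ex h hh; have [x' [y' [k1 k2 k3]]] := ex k hk.
exists x, y, x', y'; split=> //; split=> // s t; have [p [e1 e2]] := hq s t.
by exists p; split; apply: halfsame_hyp => //; rewrite ?e1 ?e2; [case: (s)|case: (t)].
Qed.

Lemma first_wall x y : x <> y -> exists z, [/\ adj x z, W z x y & W z x x = false].
Proof.
move=> n; case E: (dist x y) => [|m]; first by case: n; exact: (dist_eq0 HX E).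
have [z a ez] := dist_step HX E; exists z; split=> //; last by rewrite (Wr (adj_sym HX a)).
by rewrite /W !(distC HX y) E ez.
Qed.

Lemma wall_ext x y : (forall h, wall h -> h x = h y) -> x = y.
Proof.
move=> h; apply: NNPP => /first_wall [z [a h1 h2]].
by have := h _ (wall_W (adj_sym HX a)); rewrite h1 h2.
Qed.

(** Otherwise the first two edges of a geodesic from [v] to [v'] have distinct walls, both
    separating [v] from [v'] and hence [x] from [x']; but only one hyperplane crosses the edge from
    [x] to [x']. *)
Lemma adj_transfer x x' v v' : adj x x' ->
  (forall m, wall m -> (m v != m v') = (m x != m x')) -> adj v v'.
Proof.
move=> a h; apply: (adj_dist HX).
have n : v <> v'.
  by move=> e; have := h _ (wall_W a); rewrite e eqxx Wl // Wr.
have [z [az h1 h2]] := first_wall n.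
have [e|/first_wall [z' [az' h3 h4]]] := classic (z = v').
  by rewrite -e; apply: dist_adj.
have wz := wall_W (adj_sym HX az); have wz' := wall_W (adj_sym HX az').
have lt : dist v' z < dist v' v by move: h1.
have lt' : dist v' z' < dist v' z by move: h3.
have vz' : dist v z' = 2.
  have := dist_triangle HX v z z'; have := dist_triangle HX v z' v'; have := dist_triangle HX v z v'.
  rewrite (dist_adj HX az) (dist_adj HX az') !(distC HX _ v') in lt lt' *.
  lia.
have h5 : W z' z v = false by rewrite /W vz' (dist_adj HX az).
have e1 := h _ wz; rewrite h1 h2 in e1; have e2 := h _ wz'; rewrite h3 h5 in e2.
have eq : equivw (W z v) (W z' z).
  by apply: (wall_edge2 wz wz' a); apply/eqP; rewrite -?e1 -?e2.
have := equivw_eq z v eq; rewrite h4 h5 h2 Wl; last exact: adj_sym.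
by move=> [_ /(_ erefl)].
Qed.

(** Each wall crosses some edge of a geodesic, and inequivalent walls cross different edges. *)
Lemma sep_le n (f : 'I_n -> V -> bool) x y : (forall i, wall (f i)) ->
  (forall i j, equivw (f i) (f j) -> i = j) -> (forall i, f i x <> f i y) -> n <= dist x y.
Proof.
move=> hw hi hs; have [p [p0 [pn hp]]] := dist_walk HX x y.
have ex i : exists e : 'I_(dist x y), f i (p e) <> f i (p e.+1).
  apply: NNPP => hn.
  have : forall k, k <= dist x y -> f i (p k) = f i x.
    elim=> [|k IH] hk; first by rewrite p0.
    rewrite -IH ?(ltnW hk) //; apply: NNPP => n'; apply: hn.
    by exists (Ordinal hk) => e'; apply: n'; rewrite /= in e' *.
  by move/(_ _ (leqnn _)); rewrite pn => e; apply: (hs i).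
have [e he] := fin_all_exists ex.
have inj : injective e.
  move=> i j eij; apply: hi; apply: (wall_edge2 (hw i) (hw j) (hp (e i) (ltn_ord _)) (he i)).
  by rewrite eij; apply: he.
by have := leq_card e inj; rewrite !card_ord.
Qed.

End Walls.

(** * Half-flats in the grid and a criterion for embedding them *)

Section HalfFlats.
Variable R : Z * Z -> Prop.
Hypothesis hR : is_half_flat R.

Lemma staircase_mono p i j : staircase p -> (i <= j)%Z ->
  ((p i).1 <= (p j).1)%Z /\ ((p i).2 <= (p j).2)%Z.
Proof.
move=> [hs _] hij; have -> : j = (i + Z.of_nat (Z.to_nat (j - i)))%Z by lia.
elim: (Z.to_nat _) => [|n IH]; first by rewrite Z.add_0_r; lia.
have -> : (i + Z.of_nat n.+1)%Z = (i + Z.of_nat n + 1)%Z by lia.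
case: (hs (i + Z.of_nat n)%Z) => -> /=; lia.
Qed.

Lemma half_flat_up a b : R (a, b) -> R (a, b + 1)%Z.
Proof.
case: hR => [h|[p [hp h]]] /h hx; apply/h; first by rewrite /hf_std /= in hx *; lia.
by case: hx => i /= [h1 h2]; exists i => /=; lia.
Qed.

Lemma half_flat_left a b : R (a, b) -> R (a - 1, b)%Z.
Proof.
case: hR => [h|[p [hp h]]] /h hx; apply/h => //.
case: hx => i /= [h1 h2]; have [_ [hs _]] := hp; have [j hj] := hs (a - 1)%Z.
exists j => /=; split=> //; have [le|le] : (j <= i \/ i <= j)%Z by lia.
  by have := staircase_mono hp le; lia.
by have := staircase_mono hp le; lia.
Qed.

Lemma half_flat_column k : exists b, R (k, b).
Proof.
case: hR => [h|[p [hp h]]]; first by exists 0%Z; apply/h; rewrite /hf_std /=; lia.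
by have [_ [hs _]] := hp; have [j hj] := hs k; exists (p j).2; apply/h; exists j => /=; lia.
Qed.

Lemma half_flat_upn a b n : R (a, b) -> R (a, b + Z.of_nat n)%Z.
Proof.
move=> h; elim: n => [|n IH]; first by rewrite Z.add_0_r.
by have := half_flat_up IH; congr (R (_, _)); lia.
Qed.

Definition L1 (x y : Z * Z) : nat := Z.abs_nat (x.1 - y.1) + Z.abs_nat (x.2 - y.2).

Lemma grid_adj_sym x y : grid_adj R x y -> grid_adj R y x.
Proof. by move=> [h1 [h2 h3]]; do ! split=> //; lia. Qed.

Lemma walk_up a b n : R (a, b) -> walk (grid_adj R) (a, b) (a, b + Z.of_nat n)%Z n.
Proof.
move=> h; elim: n => [|n IH]; first by rewrite Z.add_0_r; apply: walk_refl.
have -> : (b + Z.of_nat n.+1)%Z = (b + Z.of_nat n + 1)%Z by lia.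
rewrite -addn1; apply: walk_cat IH _; apply: walk1; split; first exact: half_flat_upn.
by split; [apply/half_flat_up/half_flat_upn|simpl; lia].
Qed.

Lemma walk_left a b n : R (a, b) -> walk (grid_adj R) (a, b) (a - Z.of_nat n, b)%Z n.
Proof.
move=> h; suff : walk (grid_adj R) (a, b) (a - Z.of_nat n, b)%Z n /\ R (a - Z.of_nat n, b)%Z by case.
elim: n => [|n [IH1 IH2]]; first by rewrite Z.sub_0_r; split=> //; apply: walk_refl.
have -> : (a - Z.of_nat n.+1)%Z = (a - Z.of_nat n - 1)%Z by lia.
have h' := half_flat_left IH2; split=> //.
by rewrite -addn1; apply: walk_cat IH1 _; apply: walk1; split=> //; split=> //=; lia.
Qed.

(** A path can turn in the column of the left end and the row of the right end: that corner is
    reached from the right end by moving left, so it belongs to [R]. *)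
Lemma grid_walk x y : R x -> R y -> walk (grid_adj R) x y (L1 x y).
Proof.
have wl u v : (u.1 <= v.1)%Z -> R u -> R v -> walk (grid_adj R) u v (L1 u v).
  case: u v => [a b] [a' b'] /= le ru rv.
  have w := walk_sym grid_adj_sym (walk_left (Z.to_nat (a' - a)) rv).
  have e : (a' - Z.of_nat (Z.to_nat (a' - a)))%Z = a by lia.
  rewrite e in w.
  have rc : R (a, b').
    rewrite -e; elim: (Z.to_nat _) => [|n IH]; first by rewrite Z.sub_0_r.
    by have := half_flat_left IH; congr (R (_, _)); lia.
  have -> : L1 (a, b) (a', b') = Z.abs_nat (b - b') + Z.to_nat (a' - a) by rewrite /L1 /=; lia.
  apply: walk_cat w; have [l|l] : (b <= b' \/ b' <= b)%Z by lia.
    by have := walk_up (Z.abs_nat (b - b')) ru; congr (walk _ _ (_, _)); lia.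
  apply: (walk_sym grid_adj_sym).
  by have := walk_up (Z.abs_nat (b - b')) rc; congr (walk _ _ (_, _)); lia.
move=> rx ry; have [le|le] : (x.1 <= y.1 \/ y.1 <= x.1)%Z by lia.
  exact: wl.
by have := walk_sym grid_adj_sym (wl _ _ le ry rx); congr (walk _ _ _); rewrite /L1; lia.
Qed.

Lemma grid_dist x y : R x -> R y -> is_dist (grid_adj R) x y (L1 x y).
Proof.
move=> rx ry; split; first exact: grid_walk.
move=> n; elim: n x {rx} => [|n IH] x w; first by rewrite (walk_inv0 w) /L1; lia.
have [z [_ [_ h]] w'] := walk_inv w; have := IH _ w'; rewrite /L1; lia.
Qed.

Variables (V : Type) (X : cube_complex V).
Hypothesis HX : CAT0_cube_complex X.
Variables (phi : Z * Z -> V) (a b : Z -> V -> bool).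
Hypothesis phi_adj : forall x y, grid_adj R x y -> adj X (phi x) (phi y).
Hypothesis a_wall : forall k, wall X (a k).
Hypothesis a_phi : forall k x, R x -> a k (phi x) = (k <? x.1)%Z.
(* In the standard half-flat only the rows of height at least 0 carry a wall. *)
Let row k := exists2 x, R x & (x.2 <= k)%Z.
Hypothesis b_wall : forall k, row k -> wall X (b k).
Hypothesis b_phi : forall k x, row k -> R x -> b k (phi x) = (k <? x.2)%Z.

Lemma columns_inj k l : equivw (a k) (a l) -> k = l.
Proof.
have half k' l' : (k' < l')%Z -> ~ equivw (a k') (a l').
  move=> lt e; have [u hu] := half_flat_column k'; have [v hv] := half_flat_column l'.
  by have := equivw_eq (phi (k', u)) (phi (l', v)) e; rewrite !a_phi //=; lia.
move=> e; have [|[|]] : (k = l \/ k < l \/ l < k)%Z by lia.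
- by [].
- by move/half.
- by move/half; case; apply: equivw_sym.
Qed.

Lemma rows_inj k l : row k -> row l -> equivw (b k) (b l) -> k = l.
Proof.
have half k' l' : row k' -> row l' -> (k' < l')%Z -> ~ equivw (b k') (b l').
  move=> hk hl lt e; have [[u v] hu /= le] := hk.
  have hv := half_flat_upn (Z.to_nat (l' - v)) hu.
  by have := equivw_eq (phi (u, v)) (phi (u, v + Z.of_nat (Z.to_nat (l' - v)))%Z) e; rewrite !b_phi //=; lia.
move=> hk hl e; have [|[|]] : (k = l \/ k < l \/ l < k)%Z by lia.
- by [].
- by move/half; case.
- by move/half; case=> //; apply: equivw_sym.
Qed.

Lemma column_row k l : row l -> ~ equivw (a k) (b l).
Proof.
move=> hl e; have [[u v] hu /= le] := hl.
have hv := half_flat_upn (Z.to_nat (l + 1 - v)) hu.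
have := equivw_eq (phi (u, v)) (phi (u, v + Z.of_nat (Z.to_nat (l + 1 - v)))%Z) e.
by rewrite !b_phi // !a_phi //=; lia.
Qed.

(** Grid paths bound the distance from above. From below, the columns and rows between the two
    points carry inequivalent walls separating their images, as many as the grid distance. *)
Lemma phi_dist x y : R x -> R y -> dist X (phi x) (phi y) = L1 x y.
Proof.
move=> rx ry; apply/eqP; rewrite eqn_leq; apply/andP; split.
  by apply: dist_min => //; apply: walk_map (grid_walk rx ry).
pose f (i : 'I_(L1 x y)) := match split i with
  | inl j => a (Z.min x.1 y.1 + Z.of_nat j)%Z
  | inr j => b (Z.min x.2 y.2 + Z.of_nat j)%Z end.
have hrow n : row (Z.min x.2 y.2 + Z.of_nat n)%Z.
  by have [e|e] := Z.min_spec x.2 y.2; [exists x|exists y] => //; lia.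
apply: (@sep_le _ _ HX _ f) => [i|i j|i]; rewrite /f.
- by case: split => j; [apply: a_wall|apply: b_wall].
- case: (split_ordP i) => [i' ->|i' ->]; case: (split_ordP j) => [j' ->|j' ->].
  + by move/columns_inj => e; congr lshift; apply: val_inj => /=; lia.
  + by move/(column_row (hrow _)).
  + by move/equivw_sym/(column_row (hrow _)).
  + by move/(rows_inj (hrow _) (hrow _)) => e; congr rshift; apply: val_inj => /=; lia.
- case: split => j; have := ltn_ord j; first by rewrite !a_phi //; lia.
  by rewrite !b_phi //; lia.
Qed.

(** Distances already agree; each square comes from [quadrangle] at its upper right corner, the
    closing vertex being at distance 0 from the image of the lower left one. *)
Lemma iso_half_flat_of_walls : iso_half_flat X R phi.
Proof.
split=> //; split.
  move=> x y n rx ry; rewrite is_distE // phi_dist //; split=> [|<-]; last exact: grid_dist.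
  by move=> h; apply: is_dist_fun h; apply: grid_dist.
move=> u v h00 h10 h01 h11.
have e1 : adj X (phi (u + 1, v + 1)%Z) (phi (u + 1, v)%Z) by apply: phi_adj; do ! split=> //=; lia.
have e2 : adj X (phi (u + 1, v + 1)%Z) (phi (u, v + 1)%Z) by apply: phi_adj; do ! split=> //=; lia.
have n : phi (u + 1, v)%Z <> phi (u, v + 1)%Z.
  by move=> e; have := phi_dist h10 h01; rewrite e distxx // /L1 /=; lia.
have [||p hp lt] := quadrangle HX (z := phi (u, v)) e1 e2 n.
- by rewrite !phi_dist // /L1 /=; lia.
- by rewrite !phi_dist // /L1 /=; lia.
have ep : p = phi (u, v).
  by apply: (dist_eq0 HX); rewrite distC //; move: lt; rewrite (phi_dist h00 h10) /L1 /=; lia.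
subst p; have [q [hq h1 h2 h3 h4]] := Sq_flip HX (Sq_swap HX (Sq_flip HX hp)).
by exists q.
Qed.

End HalfFlats.

(** * Counting functions of sets of integers unbounded in both directions *)

Section Counting.
Variable A : Z -> bool.

(** The witness counts the members of [A] from 0 up to [i - 1], and for negative [i] it is minus the
    number of members from [i] up to -1. *)
Lemma count_ex : exists f : Z -> Z, forall i, f (i + 1)%Z = (f i + if A i then 1 else 0)%Z.
Proof.
pose up n := (\sum_(j < n) A (Z.of_nat j))%N.
pose dn n := (\sum_(j < n) A (- 1 - Z.of_nat j)%Z)%N.
exists (fun i => if (0 <=? i)%Z then Z.of_nat (up (Z.to_nat i)) else - Z.of_nat (dn (Z.to_nat (- i))))%Z.
move=> i; case: (Z.leb_spec 0 i) => hi.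
  have -> : (0 <=? i + 1)%Z = true by lia.
  have -> : Z.to_nat (i + 1) = (Z.to_nat i).+1 by lia.
  rewrite /up big_ord_recr /= Z2Nat.id //; case: (A i); lia.
have e : Z.to_nat (- i) = (Z.to_nat (- (i + 1))).+1 by lia.
have e' : (- 1 - Z.of_nat (Z.to_nat (- (i + 1))))%Z = i by lia.
have dnS n : dn n.+1 = (dn n + A (- 1 - Z.of_nat n)%Z)%N by rewrite /dn big_ord_recr.
rewrite e dnS e'.
case: (Z.leb_spec 0 (i + 1)) => hi'; last by case: (A i); lia.
have ei : i = (-1)%Z by lia.
by rewrite ei /up /dn /= !big_ord0; case: (A _).
Qed.

Variable f : Z -> Z.
Hypothesis fS : forall i, f (i + 1)%Z = (f i + if A i then 1 else 0)%Z.
Hypothesis A_up : forall i, exists2 j, (i <= j)%Z & A j.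
Hypothesis A_dn : forall i, exists2 j, (j < i)%Z & A j.

Lemma count_mono i j : (i <= j)%Z -> (f i <= f j)%Z.
Proof.
move=> hij; have -> : j = (i + Z.of_nat (Z.to_nat (j - i)))%Z by lia.
elim: (Z.to_nat _) => [|n IH]; first by rewrite Z.add_0_r; lia.
have -> : (i + Z.of_nat n.+1)%Z = (i + Z.of_nat n + 1)%Z by lia.
rewrite fS; case: (A _); lia.
Qed.

Lemma count_lt i s : A i -> (i <? s)%Z = (f i <? f s)%Z.
Proof.
move=> hA; case: (Z.ltb_spec i s) => h.
  have := @count_mono (i + 1)%Z s; rewrite fS hA; lia.
by have := count_mono h; lia.
Qed.

Lemma count_next i : exists2 j, A j & f j = f i.
Proof.
have [j le hj] := A_up i; have [n e] : exists n, j = (i + Z.of_nat n)%Z.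
  by exists (Z.to_nat (j - i)); lia.
subst j; elim: n i hj {le} => [|n IH] i hj; first by exists i => //; rewrite Z.add_0_r in hj.
case hA : (A i); first by exists i.
have [|j h1 h2] := IH (i + 1)%Z; first by move: hj; congr (is_true (A _)); lia.
by exists j => //; rewrite h2 fS hA; lia.
Qed.

Lemma count_prev i : exists2 j, A j & f j = (f i - 1)%Z.
Proof.
have [j lt hj] := A_dn i; have [n e] : exists n, i = (j + 1 + Z.of_nat n)%Z.
  by exists (Z.to_nat (i - j - 1)); lia.
subst i; elim: n {lt} => [|n [j' h1 h2]].
  by exists j => //; rewrite Z.add_0_r fS hj; lia.
case hA : (A (j + 1 + Z.of_nat n)%Z).
  exists (j + 1 + Z.of_nat n)%Z => //.
  have -> : (j + 1 + Z.of_nat n.+1)%Z = (j + 1 + Z.of_nat n + 1)%Z by lia.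
  by rewrite fS hA; lia.
exists j' => //; have -> : (j + 1 + Z.of_nat n.+1)%Z = (j + 1 + Z.of_nat n + 1)%Z by lia.
by rewrite fS hA h2; lia.
Qed.

Lemma count_surj k : exists2 i, A i & f i = k.
Proof.
have [j0 a0 _] := count_next 0.
have up n : exists2 i, A i & f i = (f j0 + Z.of_nat n)%Z.
  elim: n => [|n [i hi e]]; first by exists j0 => //; lia.
  have [j hj ej] := count_next (i + 1)%Z; exists j => //; rewrite ej fS hi; lia.
have dn n : exists2 i, A i & f i = (f j0 - Z.of_nat n)%Z.
  elim: n => [|n [i hi e]]; first by exists j0 => //; lia.
  by have [j hj ej] := count_prev i; exists j => //; lia.
have [h|h] : (f j0 <= k \/ k <= f j0)%Z by lia.
  by have [i hi e] := up (Z.to_nat (k - f j0)); exists i => //; lia.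
by have [i hi e] := dn (Z.to_nat (f j0 - k)); exists i => //; lia.
Qed.

End Counting.

(** * Walls dual to the edges of the axis *)

Section AxisWalls.
Variables (V : Type) (X : cube_complex V).
Hypothesis HX : CAT0_cube_complex X.
Local Notation Sq := (Sq X).
Local Notation adj := (adj X).
Local Notation dist := (dist X).
Local Notation wall := (wall X).
Variable c : Z -> V.
Hypothesis hc : comb_geodesic X c.

(** The side is chosen so that the halfspace contains the positive end of [c]. *)
Definition axis_wall (i : Z) : V -> bool := W X (c (i + 1)%Z) (c i).
Local Notation h := axis_wall.

Lemma dist_axis i j : dist (c i) (c j) = Z.abs_nat (i - j).
Proof. by apply/is_distE => //; apply: hc. Qed.

Lemma axis_adj i : adj (c i) (c (i + 1)%Z).
Proof. by apply: (adj_dist HX); rewrite dist_axis; lia. Qed.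

Lemma axis_wallP i : wall (h i).
Proof. by apply: wall_W; apply: adj_sym => //; apply: axis_adj. Qed.

Lemma axis_wall_c i k : h i (c k) = (i <? k)%Z.
Proof. by rewrite /axis_wall /W !dist_axis; lia. Qed.

Lemma axis_wall_inj i j : equivw (h i) (h j) -> i = j.
Proof.
by move=> e; have := equivw_eq (c i) (c (i + 1)%Z) e; rewrite !axis_wall_c; lia.
Qed.

Lemma axis_const m i : wall m -> (forall j, ~ equivw m (h j)) -> m (c i) = m (c 0%Z).
Proof.
move=> hm hn; have stp j : m (c (j + 1)%Z) = m (c j).
  apply: NNPP => n; apply: (hn j); apply: (wall_edge2 HX hm (axis_wallP j) (axis_adj j)).
    by move=> e; apply: n.
  by rewrite !axis_wall_c; lia.
have up n : m (c (Z.of_nat n)) = m (c 0%Z).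
  elim: n => // n <-; rewrite -(stp (Z.of_nat n)); congr (m (c _)); lia.
have dn n : m (c (- Z.of_nat n)%Z) = m (c 0%Z).
  elim: n => // n <-; rewrite -(stp (- Z.of_nat n.+1)%Z); congr (m (c _)); lia.
have [le|le] : (0 <= i \/ i <= 0)%Z by lia.
  by rewrite -(up (Z.to_nat i)); congr (m (c _)); lia.
by rewrite -(dn (Z.to_nat (- i))); congr (m (c _)); lia.
Qed.

Lemma equivw_neq (m k : V -> bool) p q : equivw m k -> (m p != m q) = (k p != k q).
Proof. by case=> e; rewrite !e //; case: (k p); case: (k q). Qed.

(** * Staircase half-flats from two crossing classes of axis walls *)

Section Staircase.
Variable A : Z -> bool.
Hypothesis A_up : forall i, exists2 j, (i <= j)%Z & A j.
Hypothesis A_dn : forall i, exists2 j, (j < i)%Z & A j.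
Hypothesis B_up : forall i, exists2 j, (i <= j)%Z & ~~ A j.
Hypothesis B_dn : forall i, exists2 j, (j < i)%Z & ~~ A j.
Hypothesis hAB : forall i j, (i < j)%Z -> A i -> ~~ A j -> exists p, h i p = false /\ h j p = true.

(** [v] sees the walls of class [A] as [c s] does, the other axis walls as [c t] does, and all
    remaining walls as the axis does. *)
Let Phi s t v := (forall i, h i v = if A i then (i <? s)%Z else (i <? t)%Z) /\
  (forall m, wall m -> (forall i, ~ equivw m (h i)) -> m v = m (c 0%Z)).

Lemma mixed_transfer j v v' :
  (forall i, (h i v != h i v') = (i =? j)%Z) ->
  (forall m, wall m -> (forall i, ~ equivw m (h i)) -> m v = m v') -> adj v v'.
Proof.
move=> h1 h2; apply: (adj_transfer HX (axis_adj j)) => m hm.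
have [[i e]|n] := classic (exists i, equivw m (h i)).
  by rewrite !(equivw_neq _ _ e) h1 !axis_wall_c; lia.
have n' i : ~ equivw m (h i) by move=> e; apply: n; exists i.
by rewrite (h2 m) // !(axis_const _ hm n') !eqxx.
Qed.

(** Induction on the difference of the two positions. If [t] is in [A] or [s] is not, an earlier
    vertex serves again. Otherwise the vertex [w] of positions [s + 1] and [t] has neighbours [x]
    and [y] across the walls [s] and [t], which cross by [hAB]; the fourth corner of their square is
    the vertex sought. *)
Lemma mixed_ex n s : exists v, Phi s (s + Z.of_nat n)%Z v.
Proof.
elim/ltn_ind: n s => -[|n] IH s.
  exists (c s); rewrite Z.add_0_r; split=> [i|m]; last exact: axis_const.
  by rewrite axis_wall_c; case: (A i).
have -> : (s + Z.of_nat n.+1)%Z = (s + Z.of_nat n + 1)%Z by lia.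
set t := (s + Z.of_nat n)%Z.
have [x [x1 x2]] := IH n (ltnSn _) s.
case At: (A t).
  exists x; split=> // i; rewrite x1; case Ai: (A i) => //.
  by have : i <> t by [move=> e; rewrite e At in Ai]; lia.
have [y [y1 y2]] := IH n (ltnSn _) (s + 1)%Z.
have ey : (s + 1 + Z.of_nat n)%Z = (t + 1)%Z by lia.
rewrite ey in y1.
case As: (A s); last first.
  exists y; split=> // i; rewrite y1; case Ai: (A i) => //.
  by have : i <> s by [move=> e; rewrite e As in Ai]; lia.
case: n => [|n] in IH t x x1 x2 At y y1 y2 ey *.
  by move: At; rewrite /t Z.add_0_r As.
have [w [w1 w2]] := IH n (ltnW (ltnSn _)) (s + 1)%Z.
have ew : (s + 1 + Z.of_nat n)%Z = t by rewrite /t; lia.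
rewrite ew in w1.
have wx : adj w x.
  apply: (@mixed_transfer s) => [i|m hm hn]; last by rewrite x2 // w2.
  by rewrite x1 w1 -/t; case: (Z.eqb_spec i s) => [->|ne]; rewrite ?As; case: (A i) => //; lia.
have wy : adj w y.
  apply: (@mixed_transfer t) => [i|m hm hn]; last by rewrite y2 // w2.
  by rewrite y1 w1; case: (Z.eqb_spec i t) => [->|ne]; rewrite ?At; case: (A i) => //; lia.
have [p [p1 p2]] := hAB (i := s) (j := t) ltac:(lia) As (negbT At).
have xs : h s x = false by rewrite x1 As; lia.
have ws : h s w = true by rewrite w1 As; lia.
have yt : h t y = true by rewrite y1 At; lia.
have wt : h t w = false by rewrite w1 At; lia.
have ys : h s y = true by rewrite y1 As; lia.
have nxy : x <> y by move=> e; rewrite e ys in xs.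
have [||||z hz] := wall_square HX (q := p) (axis_wallP s) (axis_wallP t) wx wy nxy.
- by rewrite xs ws.
- by rewrite yt wt.
- by rewrite p1 xs.
- by rewrite p2 yt.
exists z; split=> [i|m hm hn]; last first.
  have := Sq_wall HX hm hz; rewrite w2 // x2 // y2 //.
  by case: (m z); case: (m (c 0%Z)).
have := Sq_wall HX (axis_wallP i) hz; rewrite x1 w1 y1 -/t; case: (A i) => //.
  by rewrite eqxx; case: (h i z) => //; lia.
by case: (h i z) => //; lia.
Qed.

(** Coordinates count walls: [al] those in [A], [be] the others. The axis becomes the staircase [p],
    and the points above it are the mixed vertices. *)
Lemma staircase_half_flat : lies_in_half_flat X c.
Proof.
have [al alS] := count_ex A; have [be beS] := count_ex (fun i => ~~ A i).
have al_lt := count_lt alS; have be_lt := count_lt beS.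
have al_surj := count_surj alS A_up A_dn; have be_surj := count_surj beS B_up B_dn.
pose p i := (al i, be i); pose R := hf_stair p.
have hp : staircase p.
  split; last by split=> k; [have [i _ e] := al_surj k|have [i _ e] := be_surj k]; exists i.
  by move=> i; rewrite /p /= alS beS; case: (A i) => /=; [left|right]; congr (_, _); lia.
have hR : is_half_flat R by right; exists p.
pose Psi x v := (forall i, h i v = if A i then (al i <? x.1)%Z else (be i <? x.2)%Z) /\
  (forall m, wall m -> (forall i, ~ equivw m (h i)) -> m v = m (c 0%Z)).
pose phi x := epsilon (inhabits (c 0%Z)) (Psi x).
have Psi_p i : Psi (p i) (c i).
  split=> [j|m]; last exact: axis_const.
  rewrite axis_wall_c /=; case Aj: (A j); first exact: al_lt.
  by apply: be_lt; rewrite Aj.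
have phiP x : R x -> Psi x (phi x).
  move=> [i [e1 le]]; apply: epsilon_spec.
  (* The second position [t] is an index from [i] on whose count is the height of the point; [i]
     itself serves if every smaller choice has the same count. *)
  have [t [le' et]] : exists t, (i <= t)%Z /\ be t = x.2.
    have [t _ et] := be_surj x.2.
    have [l|l] : (i <= t \/ t <= i)%Z by lia.
      by exists t.
    exists i; split; first lia.
    by have := count_mono beS l; rewrite /= in le; lia.
  have [v [v1 v2]] := mixed_ex (Z.to_nat (t - i)) i; exists v; split=> // j.
  have e : (i + Z.of_nat (Z.to_nat (t - i)))%Z = t by lia.
  rewrite v1 e -e1 -et; case Aj: (A j); first exact: al_lt.
  by apply: be_lt; rewrite Aj.
have al_inj i j : A i -> A j -> (al i =? al j)%Z = (i =? j)%Z.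
  move=> ai aj; case: (Z.eqb_spec i j) => [->|ne]; first exact: Z.eqb_refl.
  by have := al_lt i j ai; have := al_lt j i aj; lia.
have be_inj i j : ~~ A i -> ~~ A j -> (be i =? be j)%Z = (i =? j)%Z.
  move=> ai aj; case: (Z.eqb_spec i j) => [->|ne]; first exact: Z.eqb_refl.
  by have := be_lt i j ai; have := be_lt j i aj; lia.
have horiz a b : R (a, b) -> R (a + 1, b)%Z -> adj (phi (a, b)) (phi (a + 1, b)%Z).
  move=> /phiP [x1 x2] /phiP [y1 y2]; have [j Aj ej] := al_surj a.
  apply: (@mixed_transfer j) => [i|m hm hn]; last by rewrite x2 // y2.
  rewrite x1 y1 /=; case Ai: (A i); first by rewrite -(al_inj i j) // -ej; lia.
  by rewrite eqxx; case: Z.eqb_spec => // e; rewrite e Aj in Ai.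
have vert a b : R (a, b) -> R (a, b + 1)%Z -> adj (phi (a, b)) (phi (a, b + 1)%Z).
  move=> /phiP [x1 x2] /phiP [y1 y2]; have [j Aj ej] := be_surj b.
  apply: (@mixed_transfer j) => [i|m hm hn]; last by rewrite x2 // y2.
  rewrite x1 y1 /=; case Ai: (A i); last by rewrite -(be_inj i j) ?Ai // -ej; lia.
  by rewrite eqxx; case: Z.eqb_spec => // e; rewrite -e Ai in Aj.
pose ia k := epsilon (inhabits 0%Z) (fun i => A i /\ al i = k).
have iaP k : A (ia k) /\ al (ia k) = k.
  by apply: (epsilon_spec _ (fun i => A i /\ al i = k)); have [i ? ?] := al_surj k; exists i.
pose ib k := epsilon (inhabits 0%Z) (fun i => ~~ A i /\ be i = k).
have ibP k : ~~ A (ib k) /\ be (ib k) = k.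
  by apply: (epsilon_spec _ (fun i => ~~ A i /\ be i = k)); have [i ? ?] := be_surj k; exists i.
exists R, phi; split; last first.
  move=> i; exists (p i); have Rp : R (p i) by exists i => /=; lia.
  split=> //; have [v1 v2] := phiP _ Rp; have [w1 w2] := Psi_p i.
  apply: (wall_ext HX) => m hm; have [[j e]|n] := classic (exists j, equivw m (h j)).
    by apply/(equivw_eq _ _ e); rewrite v1 w1.
  have n' j : ~ equivw m (h j) by move=> e; apply: n; exists j.
  by rewrite v2 // w2.
apply: (iso_half_flat_of_walls hR HX (a := fun k => h (ia k)) (b := fun k => h (ib k))).
- move=> [a b] [a' b'] [r1 [r2 /= e]].
  have [e'|[e'|[e'|e']]] : ((a' = a + 1 /\ b' = b) \/ (a = a' + 1 /\ b' = b) \/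
    (a' = a /\ b' = b + 1) \/ (a' = a /\ b = b' + 1))%Z by lia.
  + by case: e' => e1 e2; subst; apply: horiz.
  + by case: e' => e1 e2; subst; apply: adj_sym => //; apply: horiz.
  + by case: e' => e1 e2; subst; apply: vert.
  + by case: e' => e1 e2; subst; apply: adj_sym => //; apply: vert.
- by move=> k; apply: axis_wallP.
- by move=> k x /phiP [-> _]; have [-> ->] := iaP k.
- by move=> k _; apply: axis_wallP.
- by move=> k x _ /phiP [-> _]; have [/negPf -> ->] := ibP k.
Qed.

End Staircase.

(** * The standard half-flat spanned by the axis and a ray whose walls cross all axis walls *)

Section Strip.
Variable sg : nat -> V.
Hypothesis sg0 : sg 0 = c 0%Z.
Hypothesis sg_adj : forall k, adj (sg k) (sg k.+1).
Hypothesis sg_dist : forall k, dist (c 0%Z) (sg k) = k.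
Definition ray_wall (k : nat) : V -> bool := W X (sg k.+1) (sg k).
Local Notation w := ray_wall.
Hypothesis sg_quad : forall k i s, exists q, h i q = s /\ w k q.

Lemma ray_dist k l : dist (sg k) (sg l) = (k - l) + (l - k).
Proof.
have half a n : dist (sg a) (sg (a + n)) <= n.
  elim: n => [|n IH]; first by rewrite addn0 distxx.
  have := dist_triangle HX (sg a) (sg (a + n)) (sg (a + n.+1)).
  by rewrite addnS (dist_adj HX (sg_adj _)); lia.
have := dist_triangle HX (c 0%Z) (sg k) (sg l); have := dist_triangle HX (c 0%Z) (sg l) (sg k).
rewrite !sg_dist (distC HX (sg l)); case: (leqP k l) => le.
  by have := half k (l - k); rewrite subnKC //; lia.
by have := half l (k - l); rewrite subnKC ?(ltnW le) // (distC HX (sg l)); lia.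
Qed.

Lemma ray_wallP k : wall (w k).
Proof. by apply: wall_W; apply: adj_sym. Qed.

Lemma ray_wall_sg k l : w k (sg l) = (k < l).
Proof. by rewrite /ray_wall /W !ray_dist; lia. Qed.

Lemma ray_wall_axis k i : ~ equivw (w k) (h i).
Proof.
case=> e; first by have [q [h1 h2]] := sg_quad k i false; move: h2; rewrite e h1.
by have [q [h1 h2]] := sg_quad k i true; move: h2; rewrite e h1.
Qed.

Lemma ray_wall_c k i : w k (c i) = false.
Proof.
rewrite (axis_const _ (ray_wallP k)); last by move=> j; apply: ray_wall_axis.
by rewrite -sg0 ray_wall_sg.
Qed.

Lemma axis_wall_sg i k : h i (sg k) = h i (c 0%Z).
Proof.
elim: k => [|k IH]; first by rewrite sg0.
rewrite -IH; apply: NNPP => n; apply: (@ray_wall_axis k i).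
apply: (wall_edge2 HX (ray_wallP k) (axis_wallP i) (sg_adj k)); first by rewrite !ray_wall_sg; lia.
by move=> e; apply: n.
Qed.

(** [v] is the sum of [x] and [y] with origin [c 0]: the walls separating it from the origin are
    those separating exactly one of [x] and [y] from it. *)
Let Psi x y v := forall m, wall m -> m v = m x (+) m y (+) m (c 0%Z).

Lemma sum_transfer x y y' v v' : Psi x y v -> Psi x y' v' -> adj y y' -> adj v v'.
Proof.
move=> h1 h2 a; apply: (adj_transfer HX a) => m hm; rewrite h1 // h2 //.
by case: (m x); case: (m y); case: (m y'); case: (m _).
Qed.

Lemma sum_transferl x x' y v v' : Psi x y v -> Psi x' y v' -> adj x x' -> adj v v'.
Proof.
move=> h1 h2 a; apply: (adj_transfer HX a) => m hm; rewrite h1 // h2 //.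
by case: (m x); case: (m y); case: (m x'); case: (m _).
Qed.

(** [wall_square] closes the square across the axis wall [j] and the ray wall [k], which cross by
    [sg_quad]. *)
Lemma sum_step i i' k v : Psi (c i) (sg k) v -> adj (c i) (c i') ->
  (exists v', Psi (c i') (sg k) v') -> (exists v', Psi (c i) (sg k.+1) v') ->
  exists v', Psi (c i') (sg k.+1) v'.
Proof.
move=> hv a [x hx] [y hy].
have [j ej] : exists j, h j (c i) <> h j (c i').
  have [e|e] : (i' = i + 1 \/ i = i' + 1)%Z by have := dist_adj HX a; rewrite dist_axis; lia.
    by exists i; rewrite !axis_wall_c; lia.
  by exists i'; rewrite !axis_wall_c; lia.
have vx := sum_transferl hv hx a; have vy := sum_transfer hv hy (sg_adj k).
have wj := axis_wallP j; have wk := ray_wallP k.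
have wv : w k v = false by rewrite (hv _ wk) ray_wall_sg !ray_wall_c; lia.
have wx : w k x = false by rewrite (hx _ wk) ray_wall_sg !ray_wall_c; lia.
have wy : w k y = true by rewrite (hy _ wk) ray_wall_sg !ray_wall_c; lia.
have [q [q1 q2]] := sg_quad k j (h j x).
have [|||||z hz] := wall_square HX (q := q) wj wk vx vy.
- by move=> e; rewrite e wy in wx.
- move=> e; apply: ej; move: e; rewrite hx // hv // axis_wall_sg.
  by case: (h j (c i)); case: (h j (c i')); case: (h j (c 0%Z)).
- by rewrite wy wv.
- by [].
- by rewrite wy; apply: q2.
exists z => m hm; have := Sq_wall HX hm hz; rewrite hv // hx // hy //.
by case: (m z); case: (m (c i)); case: (m (c i')); case: (m (sg k)); case: (m (sg k.+1)); case: (m (c 0%Z)).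
Qed.

(** Each row is filled from the one below, starting on the ray and moving along the axis in both
    directions. *)
Lemma sum_ex i k : exists v, Psi (c i) (sg k) v.
Proof.
elim: k i => [|k IH] i.
  by exists (c i) => m _; rewrite sg0 -addbA addbb addbF.
have base : exists v, Psi (c 0%Z) (sg k.+1) v.
  by exists (sg k.+1) => m _; rewrite addbC addbA addbb.
have up n : exists v, Psi (c (Z.of_nat n)) (sg k.+1) v.
  elim: n => // n IHn; have [v hv] := IH (Z.of_nat n).
  apply: (sum_step hv _ (IH _) IHn).
  by have := axis_adj (Z.of_nat n); congr (adj _ (c _)); lia.
have dn n : exists v, Psi (c (- Z.of_nat n)%Z) (sg k.+1) v.
  elim: n => // n IHn; have [v hv] := IH (- Z.of_nat n)%Z.
  apply: (sum_step hv _ (IH _) IHn); apply: adj_sym => //.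
  by have := axis_adj (- Z.of_nat n.+1)%Z; congr (adj _ (c _)); lia.
have [le|le] : (0 <= i \/ i <= 0)%Z by lia.
  by have := up (Z.to_nat i); rewrite Z2Nat.id.
by have := dn (Z.to_nat (- i)); rewrite Z2Nat.id ?Z.opp_involutive //; lia.
Qed.

Lemma strip_half_flat : lies_in_half_flat X c.
Proof.
have hR : is_half_flat hf_std by left.
have [phi phiP] : exists phi : Z * Z -> V, forall x, Psi (c x.1) (sg (Z.to_nat x.2)) (phi x).
  exists (fun x => proj1_sig (constructive_indefinite_description _ (sum_ex x.1 (Z.to_nat x.2)))) => x.
  by case: constructive_indefinite_description.
exists hf_std, phi; split; last first.
  move=> i; exists (i, 0%Z); split; first by rewrite /hf_std /=; lia.
  apply: (wall_ext HX) => m hm.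
  by rewrite phiP //= sg0 -addbA addbb addbF.
apply: (iso_half_flat_of_walls hR HX (a := h) (b := fun k => w (Z.to_nat k))).
- move=> [a b] [a' b'] [r1 [r2 /= e]]; rewrite /hf_std /= in r1 r2.
  have [e'|[e'|[e'|e']]] : ((a' = a + 1 /\ b' = b) \/ (a = a' + 1 /\ b' = b) \/
    (a' = a /\ b' = b + 1) \/ (a' = a /\ b = b' + 1))%Z by lia.
  + case: e' => -> ->; exact: (sum_transferl (phiP (a, b)) (phiP (a + 1, b)%Z) (axis_adj a)).
  + case: e' => -> ->; apply: adj_sym => //.
    exact: (sum_transferl (phiP (a', b)) (phiP (a' + 1, b)%Z) (axis_adj a')).
  + case: e' => -> e2; subst b'; apply: (sum_transfer (phiP (a, b)) (phiP (a, b + 1)%Z)) => /=.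
    by have := sg_adj (Z.to_nat b); congr (adj _ (sg _)); lia.
  + case: e' => -> e2; subst b; apply: adj_sym => //.
    apply: (sum_transfer (phiP (a, b')) (phiP (a, b' + 1)%Z)) => /=.
    by have := sg_adj (Z.to_nat b'); congr (adj _ (sg _)); lia.
- by move=> k; apply: axis_wallP.
- move=> k x _; rewrite phiP; last exact: axis_wallP.
  by rewrite axis_wall_sg -addbA addbb addbF axis_wall_c.
- by move=> k _; apply: ray_wallP.
- move=> k x [[a b]]; rewrite /hf_std /= => h1 h2 h3; rewrite phiP; last exact: ray_wallP.
  by rewrite !ray_wall_c addbF /= ray_wall_sg; lia.
Qed.

End Strip.
End AxisWalls.

(** * Compactness and pigeonhole principles for finite lists *)

Lemma antitone_le (T : Type) (P : nat -> T -> Prop) :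
  (forall m x, P m.+1 x -> P m x) -> forall m n x, m <= n -> P n x -> P m x.
Proof.
move=> h m n x le; rewrite -(subnKC le); elim: (n - m) => [|k IH]; first by rewrite addn0.
by rewrite addnS => /h.
Qed.

(** If the head fails at some [m0], it fails from then on, so the witnesses for large [m] lie in the
    tail. *)
Lemma finite_compact (T : Type) (L : seq T) (P : nat -> T -> Prop) :
  (forall m x, P m.+1 x -> P m x) -> (forall m, exists2 x, List.In x L & P m x) ->
  exists2 x, List.In x L & forall m, P m x.
Proof.
move=> anti; elim: L => [|a L IH] h; first by have [x []] := h 0.
have [ha|/not_all_ex_not [m0 n0]] := classic (forall m, P m a); first by exists a => //; left.
have [m|x hx px] := IH; last by exists x => //; right.
have [x hx px] := h (maxn m m0).
case: hx px => [<-|hx] px.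
  by case: n0; apply: (antitone_le anti) px; apply: leq_maxr.
by exists x => //; apply: (antitone_le anti) px; apply: leq_maxl.
Qed.

Lemma pigeonhole (T : Type) (L : seq T) (f : nat -> T) :
  (forall n, List.In (f n) L) -> exists k l, k < l /\ f k = f l.
Proof.
move=> h; apply: NNPP => hn.
have inj : FinFun.Injective f.
  move=> k l e; apply/eqP; apply: contraT; rewrite neq_ltn => /orP [lt|lt]; case: hn.
    by exists k, l.
  by exists l, k.
have nd := FinFun.Injective_map_NoDup inj (List.seq_NoDup (length L).+1 0).
have := List.NoDup_incl_length nd (l' := L).
rewrite List.length_map List.length_seq => H.
have inc : List.incl (List.map f (List.seq 0 (length L).+1)) L.
  by move=> x /List.in_map_iff [n [<- _]].
by have := H inc; lia.
Qed.

(** * Geodesics from a vertex to a nearest vertex of a carrier *)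

Section Gates.
Variables (V : Type) (X : cube_complex V).
Hypothesis HX : CAT0_cube_complex X.
Local Notation adj := (adj X).
Local Notation dist := (dist X).
Local Notation wall := (wall X).

Lemma geodesic_sub (p : nat -> V) D : (forall i, i < D -> adj (p i) (p i.+1)) ->
  dist (p 0) (p D) = D -> forall i j, i <= j <= D -> dist (p i) (p j) = j - i.
Proof.
move=> hp e.
have le i n : i + n <= D -> dist (p i) (p (i + n)) <= n.
  elim: n => [|n IH] h; first by rewrite addn0 distxx.
  have := dist_triangle HX (p i) (p (i + n)) (p (i + n.+1)).
  by rewrite addnS (dist_adj HX (hp _ _)); last lia; have := IH; lia.
move=> i j /andP [h1 h2]; have := le i (j - i); have := le 0 i; have := le j (D - j).
rewrite !add0n !subnKC //; have := dist_triangle HX (p 0) (p i) (p D).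
have := dist_triangle HX (p i) (p j) (p D); lia.
Qed.

Variables (u : V -> bool) (p : nat -> V) (D : nat).
Hypothesis hu : wall u.
Hypothesis hp : forall i, i < D -> adj (p i) (p i.+1).
Hypothesis hD : dist (p 0) (p D) = D.
Variable x' : V.
Hypothesis hx : hyp X u (p D) x'.
Hypothesis hmin : forall y y', hyp X u y y' -> D <= dist (p 0) y.

Lemma hyp_sym (h : V -> bool) y y' : hyp X h y y' -> hyp X h y' y.
Proof. by move=> [a n]; split; [apply: adj_sym|move=> e; apply: n]. Qed.

(* If the wall of the [j]-th edge of the geodesic separated [p D] from a carrier
   vertex, it could be pushed along squares to [p D], which would then have a
   neighbour in the carrier closer to [p 0]. *)
Lemma gate j y y' : j < D -> hyp X u y y' -> W X (p j.+1) (p j) y.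
Proof.
move: {2}(D - j) (leqnn (D - j)) => n; elim: n j y y' => [|n IH] j y y' hn lt hy; first lia.
apply: contraT => /negPf wy; exfalso.
pose w := W X (p j.+1) (p j); rewrite -/w in wy.
have hw : wall w by apply: wall_W; apply: adj_sym => //; apply: hp.
have wp l : l <= D -> w (p l) = (j < l).
  move=> hl; rewrite /w /W; case: (ltnP j l) => jl.
    rewrite (distC HX _ (p j.+1)) (distC HX _ (p j)) !(geodesic_sub hp hD); lia.
  by rewrite !(geodesic_sub hp hD); lia.
(* By induction [y] lies beyond the walls of all later edges, so [wall_square] pushes the neighbour
   across [w] along the geodesic. *)
have fd l : j < l <= D -> exists2 z, adj (p l) z & w z = false.
  elim: l => [|l IHl]; first lia.
  move=> hl; case: (ltngtP j l) => jl; [|lia|]; last first.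
    by subst l; exists (p j); [apply: adj_sym => //; apply: hp|rewrite wp; lia].
  have [|z az wz] := IHl; first lia.
  have aw : adj (p l) (p l.+1) by apply: hp; lia.
  have hl' : wall (W X (p l.+1) (p l)) by apply: wall_W; apply: adj_sym.
  have [|||||z' hz] := wall_square HX (q := y) hw hl' az aw.
  - by move=> e; rewrite e wp in wz; lia.
  - by rewrite wz wp; lia.
  - by rewrite (Wl HX (adj_sym HX aw)) (Wr HX (adj_sym HX aw)).
  - by rewrite wy wz.
  - rewrite (Wl HX (adj_sym HX aw)).
    by apply: (IH _ _ y') => //; lia.
  exists z'; first exact: (Sq_adj HX (Sq_swap HX (Sq_flip HX (Sq_swap HX hz)))).
  have := Sq_wall HX hw hz; rewrite wz !wp; [|lia|lia].
  by rewrite (ltnW jl : j < l.+1) jl; case: (w z').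
have [|z az wz] := fd D; first lia.
have wD : w (p D) = true by rewrite wp // lt.
have w0 : w (p 0) = false by rewrite wp.
have closer z0 : adj (p D) z0 -> w z0 = false -> dist (p 0) z0 < D.
  by move=> a e; rewrite -[X in _ < X]hD; apply: (wall_closer HX hw a); rewrite ?wD ?w0 e.
have nb z0 z1 : adj (p D) z0 -> w z0 = false -> ~ hyp X u z0 z1.
  by move=> a e hz; have := closer _ a e; rewrite ltnNge (hmin hz).
have [ax nx] := hx.
have neq : ~ equivw w u.
  move=> e; apply: (nb x' (p D)) => //; last exact: hyp_sym.
  have := equivw_eq (p D) x' e; rewrite wD; case: (w x') => // -[h _].
  by case: nx; apply: h.
(* As [w] differs from [u], it does not separate [y] from [y'], while [u] does; one of the two lies
   in the quarter needed for the square. *)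
have [q [wq uq]] : exists q, w q = false /\ u q = u x'.
  have [ay ny] := hy; have wy' : w y' = false.
    rewrite -wy; apply: NNPP => n'; apply: neq; apply: (wall_edge2 HX hw hu ay) => // e.
    by apply: n'.
  case: (eqVneq (u y) (u x')) => [e|/eqP e]; first by exists y.
  by exists y'; split=> //; move: ny e; case: (u y); case: (u y'); case: (u x').
have [|||||t ht] := wall_square HX (q := q) hw hu az ax.
- move=> e; subst z; apply: neq; apply: (wall_edge2 HX hw hu az) => //.
  by rewrite wD wz.
- by rewrite wz wD.
- by move=> e; apply: nx.
- by rewrite wq wz.
- exact: uq.
apply: (nb z t) => //; split; first exact: (Sq_adj HX (Sq_swap HX (Sq_flip HX ht))).
move=> e; have := Sq_wall HX hu ht; rewrite e eqxx => /esym/eqP e'.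
by apply: nx.
Qed.

End Gates.

(** * Finiteness of balls and limit rays of geodesic segments *)

Section LocallyFinite.
Variables (V : Type) (X : cube_complex V).
Hypothesis HX : CAT0_cube_complex X.
Hypothesis LF : locally_finite X.
Local Notation adj := (adj X).
Local Notation dist := (dist X).

Lemma neighbours_finite v : exists L, forall w, adj v w -> List.In w L.
Proof.
have [L hL] := LF v; exists L => w [s [hs [h1 <-]]].
by apply: hL => //; exists (zerov 1).
Qed.

Lemma ball_finite v n : exists L, forall w, dist v w <= n -> List.In w L.
Proof.
elim: n => [|n [L hL]].
  by exists [:: v] => w; rewrite leqn0 => /eqP e; left; apply: (dist_eq0 HX).
have [L' hL'] : exists L', forall x w, List.In x L -> adj x w -> List.In w L'.
  elim: L {hL} => [|a L [L' IH]]; first by exists [::].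
  have [N hN] := neighbours_finite a; exists (N ++ L') => x w.
  by move=> [<- /hN h|hx hw]; apply: List.in_or_app; [left|right; apply: IH hw].
exists (v :: L') => w hw; case E: (dist w v) => [|m].
  by left; apply/esym/(dist_eq0 HX).
have [x ax ex] := dist_step HX E; right; apply: (hL' x); last exact: adj_sym.
by apply: hL; rewrite (distC HX) ex; rewrite (distC HX) E in hw.
Qed.

(** Koenig's lemma: as neighbours are finite in number, an initial segment shared with admissible
    geodesics for every [m] extends by one vertex. Since [Q m] gets stronger with [m], the edges of
    the limit satisfy every [Q m]. *)
Lemma konig_ray (b : V) (Q : nat -> V -> V -> Prop) :
  (forall m x y, Q m.+1 x y -> Q m x y) ->
  (forall m, exists p, [/\ p 0 = b, forall j, j < m -> adj (p j) (p j.+1) /\ Q m (p j) (p j.+1)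
     & forall j, j <= m -> dist b (p j) = j]) ->
  exists sg : nat -> V, [/\ sg 0 = b, forall k, adj (sg k) (sg k.+1),
    forall k, dist b (sg k) = k & forall k m, Q m (sg k) (sg k.+1)].
Proof.
move=> anti hS0.
pose S m (p : nat -> V) := [/\ p 0 = b, forall j, j < m -> adj (p j) (p j.+1) /\ Q m (p j) (p j.+1)
     & forall j, j <= m -> dist b (p j) = j].
have hS m : exists p, S m p by apply: hS0.
pose Good n f := forall m, exists2 p, S m p & forall j, j <= n -> p j = f j.
pose upd (f : nat -> V) k z j := if j == k then z else f j.
have Santi m p : S m.+1 p -> S m p.
  move=> [h1 h2 h3]; split=> // j hj; last by apply: h3; apply: ltnW.
  by have [a q] := h2 j (ltnW hj); split=> //; apply: anti.
have Gstep n f : Good n f -> exists z, Good n.+1 (upd f n.+1 z).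
  move=> hG; have [L hL] := neighbours_finite (f n).
  (* The index [m + n.+1] puts the edge into the new vertex within the controlled part of [p]. *)
  pose P m z := exists p, [/\ S (m + n.+1) p, forall j, j <= n -> p j = f j & p n.+1 = z].
  have [|m|z _ hz] := @finite_compact _ L P.
  - by move=> m z [p [h1 h2 h3]]; exists p; split=> //; apply: Santi; rewrite -addSn.
  - have [p hp hf] := hG (m + n.+1); have [h1 h2 h3] := hp.
    exists (p n.+1); last by exists p.
    by apply: hL; rewrite -hf //; have [] := h2 n ltac:(lia).
  exists z => m; have [p [h1 h2 h3]] := hz m; exists p.
    by apply: (antitone_le Santi) h1; lia.
  by move=> j hj; rewrite /upd; case: eqP => [->//|ne]; apply: h2; lia.
pose nxt n f := epsilon (inhabits b) (fun z => Good n.+1 (upd f n.+1 z)).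
pose F := fix F n := if n is k.+1 then upd (F k) k.+1 (nxt k (F k)) else fun=> b.
have FG n : Good n (F n).
  elim: n => [|n IH].
    move=> m; have [p hp] := hS m; exists p => // j; rewrite leqn0 => /eqP ->.
    by case: hp.
  exact: (epsilon_spec (inhabits b) (fun z => Good n.+1 (upd (F n) n.+1 z)) (Gstep _ _ IH)).
pose sg n := F n n.
have stable n j : j <= n -> F n j = sg j.
  elim: n => [|n IH]; first by rewrite leqn0 => /eqP ->.
  rewrite leq_eqVlt => /orP [/eqP -> //|hj] /=; rewrite /upd ltn_eqF //; exact: IH.
have sgS n m : exists2 p, S m p & forall j, j <= n -> p j = sg j.
  by have [p h1 h2] := FG n m; exists p => // j hj; rewrite h2 // stable.
exists sg; split=> [|k|k|k m].
- by [].
- have [p [h1 h2 h3] e] := sgS k.+1 k.+1.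
  by have [] := h2 k (ltnSn k); rewrite !e.
- have [p [h1 h2 h3] e] := sgS k k.
  by have := h3 k (leqnn k); rewrite e.
- have [p [h1 h2 h3] e] := sgS k.+1 (maxn m k.+1).
  have [_] := h2 k (leq_maxr _ _); rewrite !e // => q.
  apply: (@antitone_le _ (fun m (e : V * V) => Q m e.1 e.2) _ _ (maxn m k.+1) (sg k, sg k.+1)) => //.
    by move=> m' [x y]; apply: anti.
  exact: leq_maxl.
Qed.

End LocallyFinite.

(** * The group action on walls, and translation along the axis *)

Section Action.
Variables (V : Type) (X : cube_complex V).
Hypothesis HX : CAT0_cube_complex X.
Variables (G : Type) (mul : G -> G -> G) (one : G) (inv : G -> G) (act : G -> V -> V).
Hypothesis HG : is_group mul one inv.
Hypothesis HA : cubical_action X mul one act.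
Local Notation adj := (adj X).
Local Notation dist := (dist X).
Local Notation hact := (hact act).
Local Notation gpow := (gpow mul one).

Lemma actK a x : act (inv a) (act a x) = x.
Proof. by case: HA HG => [h1 [h2 _]] [_ [_ [_ [h3 _]]]]; rewrite -h2 h3 h1. Qed.

Lemma actKV a x : act a (act (inv a) x) = x.
Proof. by case: HA HG => [h1 [h2 _]] [_ [_ [_ [_ h3]]]]; rewrite -h2 h3 h1. Qed.

Lemma act_adj a x y : adj x y -> adj (act a x) (act a y).
Proof.
by case: HA => _ [_ h] [s [hs [<- <-]]]; exists (fun v => act a (s v)); split=> //; apply: h.
Qed.

Lemma dist_act a x y : dist (act a x) (act a y) = dist x y.
Proof.
have half b u v : dist (act b u) (act b v) <= dist u v.
  by apply: dist_min => //; apply: walk_map (dist_walk HX u v) => *; apply: act_adj.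
apply/eqP; rewrite eqn_leq half /=.
by have := half (inv a) (act a x) (act a y); rewrite !actK.
Qed.

Lemma W_act a x y z : W X (act a x) (act a y) (act a z) = W X x y z.
Proof. by rewrite /W !dist_act. Qed.

Lemma hact_hyp a x y : hact a (hyp X (W X x y)) = hyp X (W X (act a x) (act a y)).
Proof.
apply: rel_ext => u v; split=> [[u0 [v0 [[h1 h2] [<- <-]]]]|[h1 h2]].
  by split; [apply: act_adj|rewrite !W_act].
exists (act (inv a) u), (act (inv a) v); rewrite !actKV; split=> //; split; first exact: act_adj.
by rewrite -(W_act a) actKV -(W_act a _ _ (act _ v)) actKV.
Qed.

Lemma hyperplane_hact a H : hyperplane X H -> hyperplane X (hact a H).
Proof.
move=> /(hyperplaneP HX) [h [[x [y [axy e]]] ->]].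
have -> : hyp X h = hyp X (W X x y) by apply: hyp_equiv; left.
by rewrite hact_hyp; apply: (hyperplane_hyp HX); apply: wall_W; apply: act_adj.
Qed.

Lemma hact_mul a b H : hact (mul a b) H = hact a (hact b H).
Proof.
case: HA => _ [h2 _]; apply: rel_ext => x y; split.
  move=> [x0 [y0 [h [<- <-]]]]; exists (act b x0), (act b y0); rewrite -!h2; split=> //.
  by exists x0, y0.
by move=> [x1 [y1 [[x0 [y0 [h [<- <-]]]] [<- <-]]]]; exists x0, y0; rewrite !h2.
Qed.

Lemma hact_inj a H K : hact a H = hact a K -> H = K.
Proof.
have half L : hact (inv a) (hact a L) = L.
  rewrite -hact_mul; case: HG => [_ [_ [_ [-> _]]]]; case: HA => h1 _.
  apply: rel_ext => x y; split; first by move=> [x0 [y0 [h [<- <-]]]]; rewrite !h1.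
  by move=> h; exists x, y; rewrite !h1.
by move=> e; rewrite -(half H) e half.
Qed.

Lemma hact_gpowD a m n H : hact (gpow a (m + n)) H = hact (gpow a m) (hact (gpow a n) H).
Proof.
case: HG => hA [h1 _]; have e k l : gpow a (k + l) = mul (gpow a k) (gpow a l).
  by elim: k => [|k IH]; rewrite /gpow /= ?h1 // -/(gpow a _) IH hA.
by rewrite e hact_mul.
Qed.

Variables (g : G) (c : Z -> V) (tau : nat).
Hypothesis hc : comb_geodesic X c.
Hypothesis tau_gt0 : 0 < tau.
Hypothesis hg : forall i, act g (c i) = c (i + Z.of_nat tau)%Z.
Local Notation h := (axis_wall X c).
Local Notation T := (Z.of_nat tau).

Lemma axis_wall_act i z : h (i + T)%Z (act g z) = h i z.
Proof.
rewrite /axis_wall -hg; have -> : (i + T + 1)%Z = (i + 1 + T)%Z by lia.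
by rewrite -hg W_act.
Qed.

Lemma hact_axis i : hact g (hyp X (h i)) = hyp X (h (i + T)%Z).
Proof.
rewrite hact_hyp !hg; congr (hyp X (W X (c _) _)); lia.
Qed.

Lemma axis_wall_gpow n i z : h (i + Z.of_nat n * T)%Z (act (gpow g n) z) = h i z.
Proof.
case: HA => h1 [h2 _]; elim: n => [|n IH]; first by rewrite Z.add_0_r /gpow /= h1.
have -> : gpow g n.+1 = mul g (gpow g n) by [].
rewrite h2 -IH -[RHS]axis_wall_act; congr (h _ _); nia.
Qed.

(* [None]: the carrier of U meets both sides of the wall h i;
   [Some b]: it lies in the side where h i has value b. *)
Definition holds (t : option bool) (U : V -> V -> Prop) (i : Z) : Prop :=
  match t with
  | None => forall b, exists x y, U x y /\ h i x = b
  | Some b => forall x y, U x y -> h i x = b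
  end.

Lemma holds_hact t U i : holds t (hact g U) (i + T)%Z <-> holds t U i.
Proof.
case: t => [b|] /=; split=> H.
- by move=> x y hU; rewrite -axis_wall_act; apply: (H _ (act g y)); exists x, y.
- by move=> x y [x0 [y0 [hU [<- _]]]]; rewrite axis_wall_act; apply: H hU.
- move=> b; have [x [y [[x0 [y0 [hU [<- _]]]] <-]]] := H b.
  by exists x0, y0; rewrite axis_wall_act.
- move=> b; have [x [y [hU <-]]] := H b.
  exists (act g x), (act g y); rewrite axis_wall_act; split=> //.
  by exists x, y.
Qed.

(** [U'] is the translate of [U] by the [k]-th power of [g]. *)
Lemma holds_shift U (k : Z) : hyperplane X U ->
  exists2 U', hyperplane X U' & forall t i, holds t U' (i + k * T)%Z <-> holds t U i.
Proof.
move=> hU; have up n : exists2 U', hyperplane X U' & forall t i, holds t U' (i + Z.of_nat n * T)%Z <-> holds t U i.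
  elim: n => [|n [U' h1 h2]]; first by exists U => // t i; rewrite Z.add_0_r.
  exists (hact g U'); first exact: hyperplane_hact.
  move=> t i; rewrite -h2 -(holds_hact t U').
  by have -> : (i + Z.of_nat n.+1 * T)%Z = (i + Z.of_nat n * T + T)%Z by nia.
have dn n : exists2 U', hyperplane X U' & forall t i, holds t U' (i + - Z.of_nat n * T)%Z <-> holds t U i.
  elim: n => [|n [U' h1 h2]]; first by exists U => // t i; rewrite Z.add_0_r.
  exists (hact (inv g) U'); first exact: hyperplane_hact.
  have e : hact g (hact (inv g) U') = U'.
    rewrite -hact_mul; case: HG => [_ [_ [_ [_ ->]]]]; case: HA => a1 _.
    apply: rel_ext => x y; split; first by move=> [x0 [y0 [h [<- <-]]]]; rewrite !a1.
    by move=> h; exists x, y; rewrite !a1.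
  move=> t i; rewrite -h2 -(holds_hact t (hact (inv g) U')) e.
  by have -> : (i + - Z.of_nat n.+1 * T + T)%Z = (i + - Z.of_nat n * T)%Z by nia.
have [le|le] : (0 <= k \/ k <= 0)%Z by lia.
  have [U' h1 h2] := up (Z.to_nat k); exists U' => // t i.
  by have := h2 t i; rewrite Z2Nat.id.
have [U' h1 h2] := dn (Z.to_nat (- k)); exists U' => // t i.
by have := h2 t i; rewrite Z2Nat.id ?Z.opp_involutive //; lia.
Qed.

Lemma hyperplane_edge U : hyperplane X U -> exists x y, U x y.
Proof. by move=> [x [y [a e]]]; exists x, y; apply/e; apply: rst_refl. Qed.

(** * Nesting of translates of axis walls *)

Section Nesting.
Hypothesis SLF : strongly_locally_finite X.

(** Otherwise the infinitely many hyperplanes at [i + n T] would cross pairwise, against strong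
    local finiteness: three quarters contain axis vertices, and a translate of a point violating the
    nesting lies in the fourth. *)
Lemma nest_ex i : exists2 n, 0 < n & forall p, h (i + Z.of_nat n * T)%Z p -> h i p.
Proof.
apply: NNPP => hn.
have bad n : 0 < n -> exists p, h (i + Z.of_nat n * T)%Z p /\ h i p = false.
  move=> n0; apply: NNPP => hp; apply: hn; exists n => // p hip; apply: NNPP => /negP/negPf e.
  by apply: hp; exists p.
pose w n := h (i + Z.of_nat n * T)%Z.
have quad n m : n < m -> forall s t, exists p, w n p = s /\ w m p = t.
  move=> lt [] [].
  - by exists (c (i + Z.of_nat m * T + 1)%Z); rewrite /w !axis_wall_c //; nia.
  - by exists (c (i + Z.of_nat m * T)%Z); rewrite /w !axis_wall_c //; nia.
  - have [|p [p1 p2]] := bad (m - n); first lia.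
    exists (act (gpow g n) p); rewrite /w axis_wall_gpow; split=> //.
    have -> : (i + Z.of_nat m * T)%Z = (i + Z.of_nat (m - n) * T + Z.of_nat n * T)%Z by nia.
    by rewrite axis_wall_gpow.
  - by exists (c i); rewrite /w !axis_wall_c //; nia.
have winj n m : hyp X (w n) = hyp X (w m) -> n = m.
  move=> e; have := axis_wall_inj HX hc (hyp_inj HX (axis_wallP HX hc _) (axis_wallP HX hc _) e).
  nia.
have [_ /(_ (fun H => exists n, H = hyp X (w n)))] := SLF; case.
- by move=> _ [n ->]; apply: (hyperplane_hyp HX); apply: axis_wallP.
- move=> _ _ [n ->] [m ->] ne; apply: (cross_hyp HX); try exact: axis_wallP.
  have [lt|lt|e] := ltngtP n m; first exact: quad.
    by move=> s t; have [p [? ?]] := quad _ _ lt t s; exists p.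
  by case: ne; rewrite e.
move=> L hL; have [n|k [l [lt e]]] := @pigeonhole _ L (fun n => hyp X (w n)).
  by apply: hL; exists n.
by move/winj: e => e; rewrite e ltnn in lt.
Qed.

Lemma axis_wall_actV i z : h (i + T)%Z z = h i (act (inv g) z).
Proof. by rewrite -[RHS]axis_wall_act actKV. Qed.

Lemma nest_shift i k K : (forall p, h (i + K)%Z p -> h i p) ->
  forall p, h (i + k * T + K)%Z p -> h (i + k * T)%Z p.
Proof.
pose Q i := forall p, h (i + K)%Z p -> h i p.
have QS j : Q j <-> Q (j + T)%Z.
  split=> H p.
    have -> : (j + T + K)%Z = (j + K + T)%Z by lia.
    by rewrite !axis_wall_actV; apply: H.
  rewrite -axis_wall_act -(axis_wall_act j).
  have -> : (j + K + T)%Z = (j + T + K)%Z by lia.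
  exact: H.
have up n j : Q j <-> Q (j + Z.of_nat n * T)%Z.
  elim: n => [|n IH]; first by rewrite Z.add_0_r.
  by rewrite IH QS; have -> : (j + Z.of_nat n * T + T = j + Z.of_nat n.+1 * T)%Z by nia.
move=> hi; rewrite -/(Q _); have [le|le] : (0 <= k \/ k <= 0)%Z by lia.
  by have [H _] := up (Z.to_nat k) i; rewrite Z2Nat.id // in H; apply: H.
apply/(up (Z.to_nat (- k))); rewrite Z2Nat.id; last lia.
by have -> : (i + k * T + - k * T)%Z = i by lia.
Qed.

Lemma nest_mul i n m : (forall p, h (i + Z.of_nat n * T)%Z p -> h i p) ->
  forall p, h (i + Z.of_nat (m * n) * T)%Z p -> h i p.
Proof.
move=> hi; elim: m => [|m IH] p; first by rewrite Z.add_0_r.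
have := nest_shift (k := Z.of_nat (m * n)) hi (p := p).
have -> : (i + Z.of_nat (m * n) * T + Z.of_nat n * T = i + Z.of_nat (m.+1 * n) * T)%Z by nia.
by move=> h1 /h1 /IH.
Qed.

(** The periods found for the residue classes modulo [T] are multiplied together, and powers of [g]
    carry the inclusions to all indices. *)
Lemma nest_common : exists2 n, 0 < n & forall i p, h (i + Z.of_nat n * T)%Z p -> h i p.
Proof.
have common r : exists2 n, 0 < n & forall i, i < r ->
    forall p, h (Z.of_nat i + Z.of_nat n * T)%Z p -> h (Z.of_nat i) p.
  elim: r => [|r [n n0 hn]]; first by exists 1.
  have [m m0 hm] := nest_ex (Z.of_nat r); exists (m * n); first by rewrite muln_gt0 m0.
  move=> i; rewrite ltnS leq_eqVlt => /orP [/eqP ->|lt] p; last by apply: nest_mul; apply: hn.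
  by rewrite mulnC; apply: nest_mul.
have [n n0 hn] := common tau; exists n => // i p.
have e : i = (Z.of_nat (Z.to_nat (i mod T)) + (i / T) * T)%Z by have := Z.div_mod i T; have := Z.mod_pos_bound i T; lia.
by rewrite e; apply: nest_shift; apply: hn; have := Z.mod_pos_bound i T; lia.
Qed.

End Nesting.

(** * Positions of carriers relative to nested walls, and chains of carriers *)

Section Periodic.
Variable n0 : nat.
Hypothesis n0_gt0 : 0 < n0.
Local Notation N := (Z.of_nat n0 * T)%Z.
Hypothesis nst : forall i p, h (i + N)%Z p -> h i p.

Lemma N_gt0 : (0 < N)%Z.
Proof. nia. Qed.

Lemma nest_le i k p : (0 <= k)%Z -> h (i + N * k)%Z p -> h i p.
Proof.
move=> k0; rewrite -(Z2Nat.id k) //; elim: (Z.to_nat k) => [|m IH]; first by rewrite Z.mul_0_r Z.add_0_r.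
have -> : (i + N * Z.of_nat m.+1 = i + N * Z.of_nat m + N)%Z by lia.
by move/nst.
Qed.

Lemma holds_true_le U i a b : (a <= b)%Z ->
  holds (Some true) U (i + N * b)%Z -> holds (Some true) U (i + N * a)%Z.
Proof.
move=> le H x y hU; apply: (@nest_le _ (b - a)%Z); first lia.
by have := H x y hU; congr (h _ _ = true); lia.
Qed.

Lemma holds_false_le U i a b : (a <= b)%Z ->
  holds (Some false) U (i + N * a)%Z -> holds (Some false) U (i + N * b)%Z.
Proof.
move=> le H x y hU; apply/negbTE/negP => hx; have := H x y hU; rewrite (@nest_le _ (b - a)%Z) //; first lia.
by move: hx; congr (is_true (h _ _)); lia.
Qed.

(** A carrier vertex beyond the last wall is beyond all earlier ones, and one before the first is
    before all later ones. *)
Lemma holds_none_between U i a k b : (a <= k <= b)%Z ->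
  holds None U (i + N * a)%Z -> holds None U (i + N * b)%Z -> holds None U (i + N * k)%Z.
Proof.
move=> le Ha Hb [].
  have [x [y [hU e]]] := Hb true; exists x, y; split=> //.
  by apply: (@nest_le _ (b - k)%Z); [lia|move: e; congr (h _ _ = true); lia].
have [x [y [hU e]]] := Ha false; exists x, y; split=> //.
apply/negbTE/negP => hx; move: e; rewrite (@nest_le _ (k - a)%Z) //; first lia.
by move: hx; congr (is_true (h _ _)); lia.
Qed.

Lemma holds_none U i : ~ holds (Some true) U i -> ~ holds (Some false) U i -> holds None U i.
Proof.
move=> h1 h2 b; apply: NNPP => hn; case: b hn => hn; [case: h2|case: h1] => x y hU.
  by apply/negbTE/negP => hx; apply: hn; exists x, y.
by apply: NNPP => /negP/negPf hx; apply: hn; exists x, y.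
Qed.

(** Consecutive carriers share a vertex, so they cannot pass to the positive side of the wall
    without one of them meeting both sides. *)
Lemma contact_chain n (f : nat -> V -> V -> Prop) l x x' y y' :
  (forall t, t < n -> contact (f t) (f t.+1)) -> f 0 x x' -> f n y y' ->
  h l x = false -> h l y = true -> exists2 t, t <= n & holds None (f t) l.
Proof.
elim: n f x x' => [|n IH] f x x' hf fx fy hx hy.
  by exists 0 => // -[]; [exists y, y'|exists x, x'].
have [w [z [z' [h1 h2]]]] := hf 0 isT; case hw: (h l w).
  by exists 0 => // -[]; [exists w, z|exists x, x'].
have [t|t le ht] := IH (fun t => f t.+1) w z' _ h2 fy hw hy; first by move=> lt; apply: hf.
by exists t.+1.
Qed.

Local Notation gam := (fun i => hyp X (h i)).

Lemma contact_adj_sym H K : contact_adj X H K -> contact_adj X K H.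
Proof.
move=> [h1 [h2 [ne [w [y [y' [h3 h4]]]]]]]; do 2 split=> //; split; first by move=> e; apply: ne.
by exists w, y', y.
Qed.

Lemma axis_edge i : hyp X (h i) (c i) (c (i + 1)%Z).
Proof. by split; [apply: axis_adj|rewrite !axis_wall_c //; lia]. Qed.

Lemma axis_edgeV i : hyp X (h i) (c (i + 1)%Z) (c i).
Proof. by apply: (hyp_sym HX); apply: axis_edge. Qed.

Lemma gam_step i : contact_adj X (gam i) (gam (i + 1)%Z).
Proof.
split; first by apply: (hyperplane_hyp HX); apply: axis_wallP.
split; first by apply: (hyperplane_hyp HX); apply: axis_wallP.
split; last by exists (c (i + 1)%Z), (c i), (c (i + 1 + 1)%Z); split; [apply: axis_edgeV|apply: axis_edge].
move=> e; have := axis_wall_inj HX hc (hyp_inj HX (axis_wallP HX hc _) (axis_wallP HX hc _) e); lia.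
Qed.

Lemma gam_walk i n : walk (contact_adj X) (gam i) (gam (i + Z.of_nat n)%Z) n.
Proof.
elim: n => [|n IH]; first by rewrite Z.add_0_r; apply: walk_refl.
rewrite -addn1; apply: walk_cat IH _; apply: walk1.
have -> : (i + Z.of_nat (n + 1))%Z = (i + Z.of_nat n + 1)%Z by lia.
exact: gam_step.
Qed.

(** * The quasi-geodesic when straddling is bounded *)

Section Bound.
Variable m0 : nat.
Hypothesis bound : forall U, hyperplane X U ->
  ~ (forall k, (Z.abs k <= Z.of_nat m0)%Z -> holds None U (N * k)%Z).
Local Notation M := (2 * Z.of_nat m0 + 1)%Z.

Lemma bound_shift U k0 : hyperplane X U ->
  ~ (forall k, (k0 <= k <= k0 + M)%Z -> holds None U (N * k)%Z).
Proof.
move=> hU H; have [U' h1 h2] := holds_shift (- ((k0 + Z.of_nat m0) * Z.of_nat n0))%Z hU.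
apply: (bound h1) => k hk; have := h2 None (N * (k + k0 + Z.of_nat m0))%Z.
have -> : (N * (k + k0 + Z.of_nat m0) + - ((k0 + Z.of_nat m0) * Z.of_nat n0) * T = N * k)%Z by ring.
by move=> ->; apply: H; lia.
Qed.

(** If [j - i] were larger, [n + 2] walls spaced by [N M] would lie between, each straddled by one
    of [n + 1] carriers. A carrier straddling two of them straddles all walls at multiples of [N] in
    between, which [bound] forbids. *)
Lemma contact_lower i j n : (i < j)%Z -> walk (contact_adj X) (gam i) (gam j) n ->
  (j - i <= N + N * M * (Z.of_nat n + 1))%Z.
Proof.
move=> ij [f [f0 [fn hf]]]; apply: NNPP => hgt; have N0 := N_gt0.
(* [N k0] is the least multiple of [N] beyond [i]. *)
pose k0 := (i / N + 1)%Z; pose l (s : 'I_n.+2) := (N * (k0 + M * Z.of_nat s))%Z.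
have hk0 : (i < N * k0 <= i + N)%Z.
  by have := Z.div_mod i N; have := Z.mod_pos_bound i N N0; rewrite /k0; nia.
have hl s : (i < l s < j)%Z by have := ltn_ord s; rewrite /l; nia.
have ex s : exists t : 'I_n.+1, holds None (f t) (l s).
  have [t lt|||||t le ht] := @contact_chain n f (l s) (c (i + 1)%Z) (c i) (c j) (c (j + 1)%Z).
  - by have [_ [_ [_]]] := hf t lt.
  - by rewrite f0; apply: axis_edgeV.
  - by rewrite fn; apply: axis_edge.
  - by rewrite axis_wall_c //; have := hl s; lia.
  - by rewrite axis_wall_c //; have := hl s; lia.
  by exists (Ordinal (le : t < n.+1)).
have [e he] := fin_all_exists ex.
have ninj : ~ injective e by move/leq_card; rewrite !card_ord ltnn.
have [s [s' [lt es]]] : exists s s' : 'I_n.+2, s < s' /\ e s = e s'.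
  apply: NNPP => hn; apply: ninj => s s' es; apply: val_inj; apply/eqP; apply: contraT.
  by rewrite neq_ltn => /orP [lt|lt]; case: hn; [exists s, s'|exists s', s].
have hU : hyperplane X (f (e s)).
  case: (ltnP (e s) n) => lt'; first by have [] := hf _ lt'.
  have -> : nat_of_ord (e s) = n by have := ltn_ord (e s); lia.
  by rewrite fn; apply: (hyperplane_hyp HX); apply: axis_wallP.
apply: (@bound_shift _ (k0 + M * Z.of_nat s)%Z hU) => k hk.
apply: (@holds_none_between _ 0 (k0 + M * Z.of_nat s) _ (k0 + M * Z.of_nat s')%Z).
- nia.
- exact: he.
- by rewrite es; apply: he.
Qed.

Lemma qg_axis_of_bound : has_qg_axis_contact X act g.
Proof.
have N0 := N_gt0.
have key i j : (i < j)%Z -> exists n, [/\ is_dist (contact_adj X) (gam i) (gam j) n,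
    (j - i <= N * (M + 1) * (Z.of_nat n + 2))%Z & (Z.of_nat n <= j - i)%Z].
  move=> ij; have := gam_walk i (Z.to_nat (j - i)).
  have -> : (i + Z.of_nat (Z.to_nat (j - i)))%Z = j by lia.
  move=> wk; have [n hn le] := is_dist_ex wk; exists n; split=> //; last lia.
  have := contact_lower ij hn.1; nia.
(* These constants absorb the bound [N + N M (n + 1)] of [contact_lower]; the other inequality holds
   because consecutive hyperplanes are in contact. *)
exists gam, (Z.to_nat (N * (M + 1))), 2; split.
  by move=> i; apply: (hyperplane_hyp HX); apply: axis_wallP.
have lamE : Z.of_nat (Z.to_nat (N * (M + 1))) = (N * (M + 1))%Z by rewrite Z2Nat.id //; nia.
move: (Z.to_nat _) lamE => lam lamE.
have lam0 : 0 < lam by nia.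
split; last first.
  split=> i; first by exists (i + T)%Z; apply: hact_axis.
  exists (i - T)%Z; rewrite hact_axis; congr (hyp X (h _)); lia.
move=> i j; have [lt|[lt|e]] : (i < j \/ j < i \/ i = j)%Z by lia.
- have [n [h1 h2 h3]] := key _ _ lt; exists n; split=> //; rewrite -lamE in h2; nia.
- have [n [h1 h2 h3]] := key _ _ lt; exists n; split; last by rewrite -lamE in h2; nia.
  have sym u v k : walk (contact_adj X) u v k -> walk (contact_adj X) v u k.
    by apply: walk_sym => *; apply: contact_adj_sym.
  by case: h1 => w1 w2; split; [apply: sym|move=> k /sym /w2].
- subst j; exists 0; split; last lia.
  by split=> //; apply: walk_refl.
Qed.

End Bound.

(** * Stable positions of carriers in each residue class *)

Section Types.
Hypothesis unbounded : forall m : nat, exists2 U, hyperplane X U &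
  forall k, (Z.abs k <= Z.of_nat m)%Z -> holds None U (N * k)%Z.

Let Good (Q : nat) (ty : Z -> option bool) := forall m : nat, exists2 U, hyperplane X U &
  forall q k, (0 <= q < Z.of_nat Q)%Z -> (Z.abs k <= Z.of_nat m)%Z -> holds (ty q) U (q + N * k)%Z.

(* Along a residue class mod N the types read (Some true)* None* (Some false)*,
   so one of three consecutive windows of equal length is constant. *)
Lemma good_extend Q ty : Good Q ty ->
  exists v, Good Q.+1 (fun q => if (q =? Z.of_nat Q)%Z then v else ty q).
Proof.
move=> hG; set q0 := Z.of_nat Q.
pose P (m : nat) v := exists2 U, hyperplane X U &
  (forall q k, (0 <= q < q0)%Z -> (Z.abs k <= Z.of_nat m)%Z -> holds (ty q) U (q + N * k)%Z) /\
  (forall k, (Z.abs k <= Z.of_nat m)%Z -> holds v U (q0 + N * k)%Z).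
have [|m|v _ hv] := @finite_compact _ [:: Some true; None; Some false] P.
- by move=> m v [U hU [h1 h2]]; exists U => //; split=> *; [apply: h1|apply: h2] => //; lia.
- have [U hU hq] := hG (3 * m + 1).
  (* A window centred at [d] is translated to centre 0; the windows of radius [m] centred at 0 and
     at distance [2m + 1] on either side fill the range up to [3m + 1]. *)
  have centre v d : (Z.abs d <= 2 * Z.of_nat m + 1)%Z ->
      (forall k, (Z.abs (k - d) <= Z.of_nat m)%Z -> holds v U (q0 + N * k)%Z) -> P m v.
    move=> hd hv; have [U' hU' hs] := holds_shift (- (d * Z.of_nat n0))%Z hU.
    have sh t q k : holds t U (q + N * (k + d))%Z -> holds t U' (q + N * k)%Z.
      have := hs t (q + N * (k + d))%Z.
      have -> : (q + N * (k + d) + - (d * Z.of_nat n0) * T = q + N * k)%Z by ring.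
      by case.
    exists U' => //; split=> [q k h1 h2|k h1]; apply: sh; first by apply: hq => //; lia.
    by apply: hv; lia.
  have [ht|ht] := classic (holds (Some true) U (q0 + N * - Z.of_nat m)%Z).
    exists (Some true); first by left.
    apply: (centre _ (- (2 * Z.of_nat m + 1))%Z); first lia.
    by move=> k hk; apply: holds_true_le ht; lia.
  have [hf|hf] := classic (holds (Some false) U (q0 + N * Z.of_nat m)%Z).
    exists (Some false); first by do 2 right; left.
    apply: (centre _ (2 * Z.of_nat m + 1)%Z); first lia.
    by move=> k hk; apply: holds_false_le hf; lia.
  exists None; first by right; left.
  apply: (centre _ 0%Z); first lia.
  move=> k hk; apply: holds_none => hx; [apply: ht|apply: hf].
    by apply: holds_true_le hx; lia.
  by apply: holds_false_le hx; lia.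
exists v => m; have [U hU [h1 h2]] := hv m; exists U => // q k hq hk.
by case: Z.eqb_spec => [->|ne]; [apply: h2|apply: h1 => //; lia].
Qed.

Lemma good_types : exists2 ty : Z -> option bool, ty 0%Z = None &
  forall m : nat, exists2 U, hyperplane X U &
  forall i, (Z.abs i <= Z.of_nat m)%Z -> holds (ty (i mod N)%Z) U i.
Proof.
have N0 := N_gt0.
(* Class 0 has type [None] by [unbounded]; the other classes are added one at a time. *)
have ex Q : exists2 ty, ty 0%Z = None & Good Q.+1 ty.
  elim: Q => [|Q [ty t0 /good_extend [v hv]]].
    exists (fun=> None) => // m; have [U hU hq] := unbounded m.
    exists U => // q k hq' hk; have -> : q = 0%Z by lia.
    exact: hq.
  by exists (fun q => if (q =? Z.of_nat Q.+1)%Z then v else ty q).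
have [ty t0 hG] := ex (Z.to_nat N); exists ty => // m; have [U hU hq] := hG m.
exists U => // i hi; have hd := Z.div_mod i N ltac:(lia); have hm := Z.mod_pos_bound i N N0.
have := hq (i mod N)%Z (i / N)%Z; rewrite [X in holds _ _ X]Z.add_comm -hd; apply; first lia.
nia.
Qed.

(** If some class has a type other than [None], that class and class 0 make both parts of the
    splitting unbounded. For [i] in [A] and [j] outside, a carrier of the prescribed types has a
    vertex before [h i] and beyond [h j], which is the crossing that [staircase_half_flat] needs. *)
Lemma half_flat_or_straddle :
  lies_in_half_flat X c \/
  (forall m : nat, exists2 U, hyperplane X U & forall i, (Z.abs i <= Z.of_nat m)%Z -> holds None U i).
Proof.
have N0 := N_gt0; have [ty t0 hty] := good_types.
have mq q k : (0 <= q < N)%Z -> ((q + N * k) mod N = q)%Z.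
  by move=> hq; rewrite Z.mul_comm Z.mod_add ?Z.mod_small //; lia.
have up q i : (0 <= q < N)%Z -> exists2 j, (i <= j)%Z & (j mod N)%Z = q.
  by move=> hq; exists (q + N * Z.abs i)%Z; [nia|rewrite mq].
have dn q i : (0 <= q < N)%Z -> exists2 j, (j < i)%Z & (j mod N)%Z = q.
  by move=> hq; exists (q + N * - (Z.abs i + 2))%Z; [nia|rewrite mq].
have two i j : exists2 U, hyperplane X U & holds (ty (i mod N)%Z) U i /\ holds (ty (j mod N)%Z) U j.
  have [U hU hi] := hty (Z.abs_nat i + Z.abs_nat j).
  by exists U => //; split; apply: hi; lia.
have z0 : (0 <= 0 < N)%Z by lia.
have [[q hq tq]|npos] := classic (exists2 q, (0 <= q < N)%Z & ty q = Some true).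
  left; apply: (staircase_half_flat HX hc (A := fun i => ty (i mod N)%Z != Some true)) => [i|i|i|i|i j _].
  - by have [j h1 h2] := up 0%Z i z0; exists j; rewrite // h2 t0.
  - by have [j h1 h2] := dn 0%Z i z0; exists j; rewrite // h2 t0.
  - by have [j h1 h2] := up q i hq; exists j; rewrite // h2 tq.
  - by have [j h1 h2] := dn q i hq; exists j; rewrite // h2 tq.
  have [U hU [hi hj]] := two i j; rewrite negbK => ni /eqP nj; rewrite nj in hj.
  case E: (ty (i mod N)%Z) ni hi => [[//|]|] _ hi.
    by have [x [y hxy]] := hyperplane_edge hU; exists x; rewrite (hi x y) // (hj x y).
  by have [x [y [hxy e]]] := hi false; exists x; rewrite e (hj x y).
have [[q hq tq]|nneg] := classic (exists2 q, (0 <= q < N)%Z & ty q = Some false).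
  left; apply: (staircase_half_flat HX hc (A := fun i => ty (i mod N)%Z == Some false)) => [i|i|i|i|i j _].
  - by have [j h1 h2] := up q i hq; exists j; rewrite // h2 tq.
  - by have [j h1 h2] := dn q i hq; exists j; rewrite // h2 tq.
  - by have [j h1 h2] := up 0%Z i z0; exists j; rewrite // h2 t0.
  - by have [j h1 h2] := dn 0%Z i z0; exists j; rewrite // h2 t0.
  have [U hU [hi hj]] := two i j; move=> /eqP ni nj; rewrite ni in hi.
  case E: (ty (j mod N)%Z) nj hj => [[|//]|] _ hj.
    by case: npos; exists (j mod N)%Z => //; apply: Z.mod_pos_bound.
  by have [x [y [hxy e]]] := hj true; exists x; rewrite e (hi x y).
right=> m; have [U hU hi] := hty m; exists U => // i /hi.
have hm := Z.mod_pos_bound i N N0.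
case E: (ty (i mod N)%Z) => [[]|//]; first by case: npos; exists (i mod N)%Z.
by case: nneg; exists (i mod N)%Z.
Qed.

End Types.
End Periodic.

(** * The standard half-flat when carriers straddle ever longer parts of the axis *)

Section Straddle.
Hypothesis LF : locally_finite X.
Hypothesis no_stab : forall (n : nat) (H : V -> V -> Prop), 0 < n -> hyperplane X H ->
  hact (gpow g n) H <> H.
Hypothesis straddle : forall m : nat, exists2 U, hyperplane X U &
  forall i, (Z.abs i <= Z.of_nat m)%Z -> holds None U i.

Lemma holds_gpow U n : (forall i, holds None U i) -> forall i, holds None (hact (gpow g n) U) i.
Proof.
move=> hU i b; have [x [y [hxy <-]]] := hU (i - Z.of_nat n * T)%Z b.
exists (act (gpow g n) x), (act (gpow g n) y); split; first by exists x, y.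
rewrite -(axis_wall_gpow n (i - Z.of_nat n * T)); congr (h _ _); lia.
Qed.

(* Otherwise local finiteness produces a hyperplane straddling every wall of the
   axis all of whose translates stay in a fixed ball, so that two coincide. *)
Lemma straddle_far (m D : nat) : exists2 U, hyperplane X U &
  (forall i, (Z.abs i <= Z.of_nat m)%Z -> holds None U i) /\
  (forall x y, U x y -> D <= dist (c 0%Z) x).
Proof.
apply: NNPP => hn.
have [L hL] := ball_finite HX LF (c 0%Z) D; pose E := List.list_prod L L.
have near U : hyperplane X U -> (forall i, (Z.abs i <= Z.of_nat m)%Z -> holds None U i) ->
    exists2 e, List.In e E & adj e.1 e.2 /\ U = hyp X (W X e.1 e.2).
  move=> hU hi; apply: NNPP => hfar; apply: hn; exists U => //; split=> // x y hxy.
  rewrite leqNgt; apply/negP => lt; apply: hfar; exists (x, y) => /=.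
    have /(hyperplaneP HX) [u [hu eu]] := hU; rewrite eu in hxy; have [axy _] := hxy.
    have := dist_triangle HX (c 0%Z) x y; rewrite (dist_adj HX axy) => tr.
    by apply: List.in_prod; apply: hL; lia.
  have /(hyperplaneP HX) [u [hu eu]] := hU; rewrite eu in hxy *; have [axy n] := hxy.
  by split=> //; apply: hyp_equiv; apply: wall_edge_equiv.
pose P (k : nat) (e : V * V) := adj e.1 e.2 /\
  forall i, (Z.abs i <= Z.of_nat k)%Z -> holds None (hyp X (W X e.1 e.2)) i.
have [|k|e _ he] := @finite_compact _ E P.
- by move=> k e [h1 h2]; split=> // i hi; apply: h2; lia.
- have [U hU hi] := straddle (maxn m k).
  have [|e he [ae eU]] := near U hU; first by move=> i hi'; apply: hi; lia.
  by exists e => //; split=> // i hi'; rewrite -eU; apply: hi; lia.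
pose U := hyp X (W X e.1 e.2).
have hU : hyperplane X U by apply: (hyperplane_hyp HX); apply: wall_W; case: (he 0).
have sU i : holds None U i by have [_] := he (Z.abs_nat i); apply; lia.
pose f n := hact (gpow g n) U.
have [n|k [l [lt ekl]]] := @pigeonhole _ (List.map (fun e => hyp X (W X e.1 e.2)) E) f.
  have [|e' he' [_ ee]] := near (f n) (hyperplane_hact _ hU); first by move=> i _; apply: holds_gpow.
  by rewrite ee; apply: (List.in_map (fun e => hyp X (W X e.1 e.2))).
apply: (@no_stab (l - k) U) => //; first by rewrite subn_gt0.
apply: (@hact_inj (gpow g k)); rewrite -hact_gpowD subnKC; last exact: ltnW.
by rewrite -/(f l) -ekl.
Qed.

(** For each [m], a geodesic runs from [c 0] to a nearest vertex of a carrier at distance at least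
    [m] straddling the walls up to index [m]. By [gate] the carrier lies beyond the walls of the
    geodesic, so its vertices fill the quarters of [Q m]; the limit ray satisfies [sg_quad]. *)
Lemma straddle_half_flat : lies_in_half_flat X c.
Proof.
pose Q (m : nat) x y := forall i s, (Z.abs i <= Z.of_nat m)%Z -> exists q, h i q = s /\ W X y x q.
have [|m|sg [s0 s1 s2 s3]] := @konig_ray _ _ LF (c 0%Z) Q.
- by move=> m x y hQ i s hi; apply: hQ; lia.
- have [U hU [hi far]] := straddle_far m m.
  have [x [x' hx hmin]] : exists x, exists2 x', U x x' & forall y y', U y y' -> dist (c 0%Z) x <= dist (c 0%Z) y.
    have [x [x' hx]] := hyperplane_edge hU.
    move: {2}(dist _ x) (leqnn (dist (c 0%Z) x)) => k; elim: k x x' hx => [|k IH] x x' hx le.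
      by exists x, x' => // y y' _; apply: leq_trans le _.
    have [hm|hm] := classic (forall y y', U y y' -> dist (c 0%Z) x <= dist (c 0%Z) y); first by exists x, x'.
    have [y [y' hy lt]] : exists y, exists2 y', U y y' & dist (c 0%Z) y < dist (c 0%Z) x.
      apply: NNPP => hn; apply: hm => y y' hy; rewrite leqNgt; apply/negP => lt.
      by apply: hn; exists y, y'.
    by apply: (IH y y') => //; lia.
  have /(hyperplaneP HX) [u [hu eU]] := hU; rewrite eU in hx hmin.
  have [p [p0 [pD hp]]] := dist_walk HX (c 0%Z) x.
  have le := far x x'; rewrite eU in le; have {}le := le hx.
  set D := dist (c 0%Z) x in pD hp hmin le.
  have dD : dist (p 0) (p D) = D by rewrite p0 pD.
  exists p; split=> // j hj; last first.
    by rewrite -p0 (geodesic_sub HX hp dD); lia.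
  have jD : j < D by lia.
  split=> [|i s hi']; first exact: hp.
  have [y [y' [hy ey]]] := hi i hi' s; rewrite eU in hy; exists y; split=> //.
  rewrite -pD in hx; rewrite -p0 in hmin.
  exact: (gate HX hu hp dD hx hmin jD hy).
apply: (strip_half_flat HX hc s0 s1 s2) => k i s.
by have [|q hq] := s3 k (Z.abs_nat i) i s; [lia|exists q].
Qed.

End Straddle.
End Action.

Theorem theorem5p2 (V : Type) (X : cube_complex V)
  (G : Type) (mul : G -> G -> G) (one : G) (inv : G -> G)
  (act : G -> V -> V) (g : G) :
  CAT0_cube_complex X -> strongly_locally_finite X ->
  is_group mul one inv -> cubical_action X mul one act ->
  comb_rank_one X act g ->
  (forall (n : nat) (H : V -> V -> Prop), (0 < n)%N -> hyperplane X H ->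
      hact act (gpow mul one g n) H <> H) ->
  has_qg_axis_contact X act g.
Proof.
move=> HX SLF HG HA [c [[hc [tau [tau0 hg]]] nhf]] no_stab.
have [n n0 nst] := nest_common HX HG HA hc tau0 hg SLF.
(* If the windows of straddled walls are bounded, the hyperplanes of the axis form the
   quasi-geodesic; otherwise [c] lies in a half-flat, against rank one. *)
have [[m bd]|unb] := classic (exists m : nat, forall U, hyperplane X U ->
  ~ (forall k, (Z.abs k <= Z.of_nat m)%Z -> holds X c None U (Z.of_nat n * Z.of_nat tau * k)%Z)).
  exact: (qg_axis_of_bound HX HG HA hc tau0 hg n0 nst bd).
case: nhf; have [m|//|] := half_flat_or_straddle HX HG HA hc tau0 hg n0 nst.
  apply: NNPP => hn; apply: unb; exists m => U hU hk; apply: hn.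
  by exists U.
by move=> st; exact: (straddle_half_flat HX HG HA hc tau0 hg (proj1 SLF) no_stab st).
Qed.
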